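(* Let $\mathbb{S}$ be the 2-sphere, let $n\geqslant 2$, and let $\big(\mathbb{S},\mathbb{S},n,d,(d_{ij})\big)$ be a branch datum. Suppose that $d$ and all $d_{ij}$ for $i=1,2$ are even. If the branch datum is realizable, then for each $i=3,\ldots,n$ the partition $(d_{ij})_{j=1,\ldots,m_i}$ of $d$ refines the partition $(d/2,d/2)$.
   Context: A branched covering is a map $f:\widetilde\Sigma\to\Sigma$ between closed connected surfaces locally modelled on $\mathbb{C}\ni z\mapsto z^k\in\mathbb{C}$, $k\geqslant 1$; the integer $k$ is the local degree at the point of $\widetilde\Sigma$ corresponding to $0$, and if $k>1$ the image point is a branching point. The degree of $f$ is the degree of the genuine covering obtained by removing the branching points and their preimages. A branch datum $\big(\widetilde\Sigma,\Sigma,n,d,(d_{ij})\big)$ consists of closed connected surfaces $\widetilde\Sigma,\Sigma$, integers $n\geqslant 0$, $d\geqslant 2$, and for each $i=1,\ldots,n$ a partition $(d_{ij})_{j=1,\ldots,m_i}$ of $d$ (positive integers with sum $d$). The datum is realizable if there exist a branched covering $f:\widetilde\Sigma\to\Sigma$ of degree $d$ and $n$ distinct points $x_1,\ldots,x_n\in\Sigma$, including all branching points of $f$, such that for each $i$ the local degrees of $f$ at the points of $f^{-1}(x_i)$ form the partition $(d_{ij})_{j=1,\ldots,m_i}$. A partition of $d$ refines $(d/2,d/2)$ if it is obtained by juxtaposing two partitions of $d/2$ and reordering. *)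

(* Defs.v *)
From HB Require Import structures.
From mathcomp Require Import all_boot all_order all_algebra.
From mathcomp Require Import all_classical all_reals all_analysis.
From mathcomp Require Import complex.
From mathcomp Require Import ring lra.

Set Implicit Arguments.
Unset Strict Implicit.
Unset Printing Implicit Defensive.

Import Order.TTheory GRing.Theory Num.Theory numFieldNormedType.Exports.

Local Open Scope classical_set_scope.
Local Open Scope card_scope.
Local Open Scope ring_scope.

(* Gives [R[i]] the topology of the complex modulus. *)
HB.instance Definition _ (R : realType) := NormedModule.copy R[i] R[i]^o.

Definition homeomorphism_between (X Y : topologicalType)
    (U : set X) (V : set Y) (phi : X -> Y) : Prop :=
  exists psi : Y -> X,
    [/\ set_fun U V phi, set_fun V U psi,
        forall x, U x -> psi (phi x) = x,
        forall y, V y -> phi (psi y) = y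
      & {within U, continuous phi} /\ {within V, continuous psi}].

Definition complex_chart (R : realType) (X : topologicalType)
    (U : set X) (phi : X -> R[i]) : Prop :=
  open U /\ exists2 V : set R[i], open V & homeomorphism_between U V phi.

(* Closed connected surfaces; second countability follows from compactness   *)
(* and the existence of charts.                                              *)
Record closed_surface (R : realType) := ClosedSurface {
  surface_carrier :> topologicalType;
  surface_nonempty : [set: surface_carrier] !=set0;
  surface_hausdorff : hausdorff_space surface_carrier;
  surface_compact : compact [set: surface_carrier];
  surface_connected : connected [set: surface_carrier];
  surface_chart : forall x : surface_carrier,
    exists (U : set surface_carrier) (phi : surface_carrier -> R[i]),
      complex_chart U phi /\ U x }.

Section branched_coverings.
Context {R : realType} {X Y : closed_surface R}.
Implicit Types (f : X -> Y) (x : X) (y : Y) (k d : nat).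

Definition local_degree f x k : Prop :=
  (0 < k)%N /\
  exists (U : set X) (phi : X -> R[i]) (V : set Y) (psi : Y -> R[i]),
    [/\ complex_chart U phi, complex_chart V psi,
        U x /\ phi x = 0, V (f x) /\ psi (f x) = 0
      & forall u, U u -> V (f u) /\ psi (f u) = phi u ^+ k].

Definition branched_covering f : Prop := forall x, exists k, local_degree f x k.

Definition branching_point f : set Y :=
  [set y | exists x k, [/\ f x = y, (1 < k)%N & local_degree f x k]].

(* The number of sheets of the covering that [f] induces over the complement *)
(* of the branching points.                                                  *)
Definition covering_degree f d : Prop :=
  forall y, ~ branching_point f y -> f @^-1` [set y] #= `I_d.

Definition local_degrees_over f y (p : seq nat) : Prop :=
  exists (s : seq X) (deg : X -> nat),
    [/\ uniq s, f @^-1` [set y] = [set` s],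
        forall x, x \in s -> local_degree f x (deg x)
      & perm_eq [seq deg x | x <- s] p].

End branched_coverings.

Definition is_partition (d : nat) (p : seq nat) : Prop :=
  all (fun k => 0 < k)%N p /\ sumn p = d.

Record branch_datum (R : realType) (X Y : closed_surface R) (n d : nat) :=
  BranchDatum {
    datum_partition :> 'I_n -> seq nat;
    datum_degree : (2 <= d)%N;
    datum_partitionP : forall i, is_partition d (datum_partition i) }.

Definition realizable (R : realType) (X Y : closed_surface R) (n d : nat)
    (D : branch_datum X Y n d) : Prop :=
  exists (f : X -> Y) (x : 'I_n -> Y),
    [/\ branched_covering f, covering_degree f d, injective x,
        forall y, branching_point f y -> exists i, x i = y
      & forall i, local_degrees_over f (x i) (D i)].

Definition refines_halves (d : nat) (p : seq nat) : Prop :=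
  exists p1 p2 : seq nat,
    [/\ is_partition d./2 p1, is_partition d./2 p2 & perm_eq p (p1 ++ p2)].

Definition unit_sphere (R : realType) : set 'rV[R]_3 :=
  [set x | \sum_i x 0 i ^+ 2 = 1].
Arguments unit_sphere R : clear implicits.

Section complex_topology.
Context {R : realType}.

Lemma normc_coord_le (z : R[i]) (e : R) :
  (`|z| < e%:C)%C -> `|complex.Re z| < e /\ `|complex.Im z| < e.
Proof.
case: z => a b; rewrite normc_def ltcR /= => h.
have le1 (u v : R) : `|u| <= Num.sqrt (u ^+ 2 + v ^+ 2).
  by rewrite -sqrtr_sqr ler_sqrt ?lerDl ?sqr_ge0// addr_ge0 ?sqr_ge0.
split; apply: le_lt_trans h => //; by rewrite addrC.
Qed.

Lemma normc_le_coord (a b : R) : (`|a +i* b| <= (`|a| + `|b|)%:C)%C.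
Proof.
rewrite normc_def lecR /=.
rewrite -(@ger0_norm _ (`|a| + `|b|)) ?addr_ge0// -sqrtr_sqr ler_sqrt ?sqr_ge0//.
rewrite sqrrD !real_normK ?num_real// addrAC lerDl mulrn_wge0 ?mulr_ge0//.
Qed.

Lemma continuous_Re : continuous (@complex.Re R : R[i] -> R).
Proof.
move=> z; have FF : Filter (nbhs (z : R[i])) by exact: nbhs_filter.
apply/(@cvgrPdist_lt _ _ _ _ FF) => e e0.
have e0C : 0 < (e%:C)%C by rewrite ltcR.
near=> w.
have : ball (z : R[i]) (e%:C)%C w by near: w; exact: nbhsx_ballx.
rewrite -ball_normE /= => /normc_coord_le[].
by case: (z) => ? ?; case: (w).
Unshelve. all: by end_near.
Qed.

Lemma continuous_Im : continuous (@complex.Im R : R[i] -> R).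
Proof.
move=> z; have FF : Filter (nbhs (z : R[i])) by exact: nbhs_filter.
apply/(@cvgrPdist_lt _ _ _ _ FF) => e e0.
have e0C : 0 < (e%:C)%C by rewrite ltcR.
near=> w.
have : ball (z : R[i]) (e%:C)%C w by near: w; exact: nbhsx_ballx.
rewrite -ball_normE /= => /normc_coord_le[].
by case: (z) => ? ?; case: (w).
Unshelve. all: by end_near.
Qed.

Lemma cvg_complex (T : Type) (F : set_system T) (FF : Filter F)
    (f g : T -> R) (a b : R) :
  f @ F --> a -> g @ F --> b ->
  (fun t => (f t +i* g t)%C : R[i]) @ F --> ((a +i* b)%C : R[i]).
Proof.
move=> fa gb; apply/cvgrPdist_lt => -[e e'].
rewrite ltcE /= => /andP[/eqP -> e0].
have e20 : 0 < e / 2 by rewrite divr_gt0.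
move/cvgrPdist_lt : fa => /(_ _ e20) fa.
move/cvgrPdist_lt : gb => /(_ _ e20) gb.
apply: filterS2 fa gb => t h1 h2.
have -> : ((a +i* b) - (f t +i* g t) = (a - f t) +i* (b - g t) :> R[i])%C by [].
apply: le_lt_trans (normc_le_coord _ _) _.
by rewrite ltcR; move: h1 h2; lra.
Qed.

Lemma continuous_mx (T : topologicalType) m n (f : T -> 'M[R]_(m, n)) :
  (forall i j, continuous (fun t => f t i j)) -> continuous f.
Proof.
move=> cf t A [P /= nP PA]; rewrite nbhs_filterE /fmap /=.
suff : \forall u \near t, forall i j, P i j (f u i j).
  by apply: filterS => u h; exact: PA.
apply: filter_forall => i; apply: filter_forall => j.
exact: (cf i j t _ (nP i j)).
Qed.

End complex_topology.

Section real_continuity.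
Context {R : realType} {T : topologicalType}.
Implicit Types (f g : T -> R) (t : T).

Lemma continuousDf f g t : continuous_at t f -> continuous_at t g ->
  continuous_at t (fun t => f t + g t).
Proof. exact: continuousD. Qed.

Lemma continuousMf f g t : continuous_at t f -> continuous_at t g ->
  continuous_at t (fun t => f t * g t).
Proof. exact: continuousM. Qed.

Lemma continuousBf f g t : continuous_at t f -> continuous_at t g ->
  continuous_at t (fun t => f t - g t).
Proof. exact: continuousB. Qed.

Lemma continuousVf f g t : g t != 0 ->
  continuous_at t f -> continuous_at t g ->
  continuous_at t (fun t => f t / g t).
Proof.
by move=> g0 cf cg; apply: continuousMf => //; exact: continuousV.
Qed.

Lemma continuous_cstf (c : R) t : continuous_at t (fun=> c).
Proof. exact: cvg_cst. Qed.

End real_continuity.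

Section sphere.
Context {R : realType}.
Local Notation S := (set_type (unit_sphere R)).
Local Notation i0 := (ord0 : 'I_3).
Local Notation i1 := (lift ord0 ord0 : 'I_3).
Local Notation i2 := (lift ord0 (lift ord0 ord0) : 'I_3).

Lemma unit_sphereE (x : 'rV[R]_3) :
  unit_sphere R x = (x 0 i0 ^+ 2 + x 0 i1 ^+ 2 + x 0 i2 ^+ 2 = 1).
Proof. by rewrite /unit_sphere /= !big_ord_recl big_ord0 addr0 addrA. Qed.

Lemma ord3P (P : 'I_3 -> Prop) : P i0 -> P i1 -> P i2 -> forall i, P i.
Proof.
move=> p0 p1 p2 [[|[|[|//]]] h]; [move: p0|move: p1|move: p2];
  by congr P; apply/val_inj.
Qed.

Definition to_sphere (x : 'rV[R]_3) (h : unit_sphere R x) : S :=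
  exist _ x (mem_set h).

Lemma to_sphereK (x : 'rV[R]_3) (h : unit_sphere R x) :
  set_val (to_sphere h) = x.
Proof. by []. Qed.

Lemma sphere_valP (p : S) : unit_sphere R (set_val p).
Proof. exact: set_valP. Qed.

Lemma sphere_val_inj (p q : S) : set_val p = set_val q -> p = q.
Proof. exact: val_inj. Qed.

Lemma continuous_sphere_val : continuous (set_val : S -> 'rV[R]_3).
Proof. exact: initial_continuous. Qed.

Lemma continuous_to_sphere (T : topologicalType) (f : T -> S) :
  continuous (fun t => set_val (f t)) -> continuous f.
Proof. exact: continuous_comp_initial. Qed.

Lemma continuous_sphere_coord i : continuous (fun p : S => set_val p 0 i).
Proof.
move=> p.
apply: (@continuous_comp _ _ _ (set_val : S -> 'rV[R]_3) (fun x => x 0 i)).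
  exact: continuous_sphere_val.
exact: coord_continuous.
Qed.

Lemma sphere_hausdorff : hausdorff_space S.
Proof.
have hM : hausdorff_space 'rV[R]_3 by exact: norm_hausdorff.
move=> p q pq; apply: sphere_val_inj; apply: hM => A B nA nB.
have [r [Ar Br]] := pq _ _ (continuous_sphere_val nA) (continuous_sphere_val nB).
by exists (set_val r).
Qed.

Lemma pole_proof (s : R) : s ^+ 2 = 1 ->
  unit_sphere R (\row_i (if i == i2 then s else 0)).
Proof. by move=> s1; rewrite unit_sphereE !mxE /= expr0n /= !add0r. Qed.

Lemma unit_sphere_compact : compact (unit_sphere R).
Proof.
apply: bounded_closed_compact.
  exists 1; split => // M M1 x; rewrite unit_sphereE => h.
  rewrite /= [leLHS](mx_normrE x); apply: bigmax_le; first by apply: ltW; lra.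
  move=> [i j] _ /=; rewrite (ord1 i).
  apply: le_trans (ltW M1); rewrite -[leRHS](@normr1 R) -ler_sqr ?nnegrE//.
  rewrite !real_normK ?num_real// expr1n -h.
  by elim/ord3P : j; nra.
have -> : unit_sphere R =
    (fun x => x 0 i0 * x 0 i0 + x 0 i1 * x 0 i1 + x 0 i2 * x 0 i2) @^-1` [set 1].
  by apply/seteqP; split => x; rewrite unit_sphereE.
apply: preimage_closed; last first.
  exact: accessible_closed_set1 (hausdorff_accessible (@Rhausdorff R)) _.
have cc i (x : 'rV[R]_3) : {for x, continuous (fun x : 'rV[R]_3 => x 0 i)}.
  exact: coord_continuous.
move=> x _; apply: continuousDf; first apply: continuousDf;
  exact: (continuousMf (cc _ _) (cc _ _)).
Qed.

Lemma sphere_compact : compact [set: S].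
Proof.
pose N := to_sphere (pole_proof (expr1n R 2)).
pose g (x : 'rV[R]_3) : S :=
  if pselect (unit_sphere R x) is left h then to_sphere h else N.
have gK x : unit_sphere R x -> set_val (g x) = x.
  by rewrite /g; case: pselect.
have -> : [set: S] = g @` unit_sphere R.
  apply/seteqP; split => // p _; exists (set_val p); first exact: sphere_valP.
  by apply: sphere_val_inj; rewrite gK//; exact: sphere_valP.
apply: continuous_compact; last exact: unit_sphere_compact.
apply: continuous_to_sphere.
apply: (@subspace_eq_continuous _ (unit_sphere R) 'rV[R]_3 id
          (fun x => set_val (g x))) => [x|].
  by move/set_mem => Ax /=; rewrite /from_subspace /= gK.
apply: (@continuous_subspaceT _ _ (unit_sphere R) id) => x; exact: cvg_id.
Qed.


Definition stereo (s : R) (p : S) : R[i] :=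
  ((set_val p 0 i0 / (1 - s * set_val p 0 i2)) +i*
   (set_val p 0 i1 / (1 - s * set_val p 0 i2)))%C.

Definition stereo_dom (s : R) : set S := [set p : S | s * set_val p 0 i2 < 1].

Definition sqnorm (z : R[i]) : R := complex.Re z * complex.Re z +
  complex.Im z * complex.Im z.

Lemma sqnorm_ge0 z : 0 <= sqnorm z.
Proof. by rewrite addr_ge0// -expr2 sqr_ge0. Qed.

Lemma sqnorm1_neq0 z : sqnorm z + 1 != 0.
Proof. by rewrite gt_eqF// ltr_wpDl// sqnorm_ge0. Qed.

Definition stereo_inv_vec (s : R) (z : R[i]) : 'rV[R]_3 :=
  \row_i (if i == i0 then complex.Re z * 2 / (sqnorm z + 1)
           else if i == i1 then complex.Im z * 2 / (sqnorm z + 1)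
           else s * (sqnorm z - 1) / (sqnorm z + 1)).

Lemma stereo_inv_proof s z : s ^+ 2 = 1 -> unit_sphere R (stereo_inv_vec s z).
Proof.
move=> s1; rewrite unit_sphereE !mxE /=; have := sqnorm1_neq0 z.
rewrite !expr_div_n !exprMn s1; set q := sqnorm z => q0.
have e : complex.Re z ^+ 2 = q - complex.Im z ^+ 2 by rewrite /q /sqnorm; ring.
by rewrite e; field.
Qed.

Definition stereo_inv s (s1 : s ^+ 2 = 1) (z : R[i]) : S :=
  to_sphere (stereo_inv_proof z s1).

Lemma stereo_inv_dom s (s1 : s ^+ 2 = 1) z : stereo_dom s (stereo_inv s1 z).
Proof.
rewrite /stereo_dom /= to_sphereK !mxE /= !mulrA -expr2 s1 mul1r.
rewrite ltr_pdivrMr; have := sqnorm_ge0 z; lra.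
Qed.

Lemma stereo_invK s (s1 : s ^+ 2 = 1) z : stereo s (stereo_inv s1 z) = z.
Proof.
rewrite /stereo to_sphereK !mxE /= !mulrA -expr2 s1 mul1r.
have := sqnorm1_neq0 z; move: (sqnorm z) => q q0.
by case: z => a b /=; congr (_ +i* _)%C; field; rewrite q0 /= ; apply/eqP; lra.
Qed.

Lemma stereoK s (s1 : s ^+ 2 = 1) p : stereo_dom s p ->
  stereo_inv s1 (stereo s p) = p.
Proof.
move=> dp; apply: sphere_val_inj; rewrite to_sphereK; apply/rowP.
have := sphere_valP p; rewrite unit_sphereE => h.
move: dp; rewrite /stereo_dom /= => dp.
have d0 : 1 - s * set_val p 0 i2 != 0 by rewrite subr_eq0 gt_eqF.
suff e : sqnorm (stereo s p) + 1 = 2 / (1 - s * set_val p 0 i2).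
  have e' : sqnorm (stereo s p) = 2 / (1 - s * set_val p 0 i2) - 1.
    by rewrite -e addrK.
  elim/ord3P; rewrite !mxE /= e ?e'.
  - by field.
  - by field.
  - by rewrite -[RHS]mul1r -[X in _ = X * _]s1; field.
rewrite /sqnorm /=.
move: h d0; move: (set_val p 0 i0) (set_val p 0 i1) (set_val p 0 i2) => a b c h d0.
move: d0; set t := 1 - s * c => d0.
have -> : a / t * (a / t) + b / t * (b / t) = (a ^+ 2 + b ^+ 2) / t ^+ 2 by field.
have -> : a ^+ 2 + b ^+ 2 = 2 * t - t ^+ 2.
  have c2 : c ^+ 2 = (s * c) ^+ 2 by rewrite exprMn s1 mul1r.
  by apply: (addIr (c ^+ 2)); rewrite h c2 /t; ring.
by field.
Qed.

Lemma stereo_dom_open s : open (stereo_dom s).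
Proof.
rewrite (_ : stereo_dom s =
  (fun p : S => s * set_val p 0 i2) @^-1` [set x : R | x < 1])//.
apply: open_comp; last exact: open_lt.
move=> p _; apply: continuousMf; first exact: continuous_cstf.
exact: continuous_sphere_coord.
Qed.

Lemma continuous_stereo s : {within stereo_dom s, continuous (stereo s)}.
Proof.
apply: continuous_in_subspaceT => p /set_mem; rewrite /stereo_dom /= => dp.
have d0 : 1 - s * set_val p 0 i2 != 0 by rewrite subr_eq0 gt_eqF.
have cd : continuous_at p (fun p : S => 1 - s * set_val p 0 i2).
  apply: continuousBf; first exact: continuous_cstf.
  apply: continuousMf; first exact: continuous_cstf.
  exact: continuous_sphere_coord.
have ci i : continuous_at p
    (fun p : S => set_val p 0 i / (1 - s * set_val p 0 i2)).
  by apply: continuousVf => //; exact: continuous_sphere_coord.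
exact: (cvg_complex _ (ci i0) (ci i1)).
Qed.

Lemma continuous_stereo_inv s (s1 : s ^+ 2 = 1) : continuous (stereo_inv s1).
Proof.
apply: continuous_to_sphere; apply: continuous_mx => i j.
have cq : continuous sqnorm.
  by move=> z; apply: continuousDf; apply: continuousMf;
    [exact: continuous_Re|exact: continuous_Re|
     exact: continuous_Im|exact: continuous_Im].
have cq1 z : continuous_at z (fun z => sqnorm z + 1).
  by apply: continuousDf; [exact: cq|exact: continuous_cstf].
have -> : (fun z => set_val (stereo_inv s1 z) i j) =
    (fun z => stereo_inv_vec s z 0 j) by apply/funext => z; rewrite (ord1 i).
elim/ord3P : j => z.
- have -> : (fun z => stereo_inv_vec s z 0 i0) =
      (fun z => complex.Re z * 2 / (sqnorm z + 1)).
    by apply/funext => w; rewrite mxE.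
  apply: continuousVf => //; first exact: sqnorm1_neq0.
  apply: continuousMf; [exact: continuous_Re|exact: continuous_cstf].
- have -> : (fun z => stereo_inv_vec s z 0 i1) =
      (fun z => complex.Im z * 2 / (sqnorm z + 1)).
    by apply/funext => w; rewrite mxE.
  apply: continuousVf => //; first exact: sqnorm1_neq0.
  apply: continuousMf; [exact: continuous_Im|exact: continuous_cstf].
- have -> : (fun z => stereo_inv_vec s z 0 i2) =
      (fun z => s * (sqnorm z - 1) / (sqnorm z + 1)).
    by apply/funext => w; rewrite mxE.
  apply: continuousVf => //; first exact: sqnorm1_neq0.
  apply: continuousMf; first exact: continuous_cstf.
  by apply: continuousBf; [exact: cq|exact: continuous_cstf].
Qed.

Lemma stereo_chart s : s ^+ 2 = 1 -> complex_chart (stereo_dom s) (stereo s).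
Proof.
move=> s1; split; first exact: stereo_dom_open.
exists setT; first exact: openT.
exists (stereo_inv s1); split => //.
- by move=> z _; exact: stereo_inv_dom.
- by move=> p; exact: stereoK.
- by move=> z _; exact: stereo_invK.
- split; first exact: continuous_stereo.
  by apply: continuous_subspaceT; exact: continuous_stereo_inv.
Qed.

Lemma sqrrN1 : (-1) ^+ 2 = 1 :> R. Proof. by rewrite sqrrN expr1n. Qed.

Lemma stereo_cover p : stereo_dom 1 p \/ stereo_dom (-1) p.
Proof.
have [h|h] := ltP (set_val p 0 i2) 1; first by left; rewrite /stereo_dom /= mul1r.
by right; rewrite /stereo_dom /=; lra.
Qed.

Lemma stereo_dom_connected s : s ^+ 2 = 1 -> connected (stereo_dom s).
Proof.
move=> s1.
pose ray (z : R[i]) (t : R) : S :=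
  stereo_inv s1 (t * complex.Re z +i* (t * complex.Im z))%C.
have -> : stereo_dom s = \bigcup_(z in [set: R[i]]) range (ray z).
  apply/seteqP; split => [p dp|p [z _ [t _ <-]]]; last exact: stereo_inv_dom.
  exists (stereo s p) => //; exists 1 => //.
  by rewrite /ray !mul1r -[RHS](stereoK s1 dp); case: (stereo s p).
apply: bigcup_connected.
  exists (stereo_inv s1 (0 +i* 0)%C) => z _; exists 0 => //.
  by rewrite /ray !mul0r.
move=> z _; apply: connected_continuous_connected.
  by apply/connected_intervalP.
apply: continuous_subspaceT => t.
apply: (@continuous_comp _ _ _
  (fun t : R => (t * complex.Re z +i* (t * complex.Im z))%C : R[i])).
  have ct c : continuous_at t (fun t : R => t * c).
    by apply: continuousMf; [exact: cvg_id|exact: continuous_cstf].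
  exact: (cvg_complex _ (ct _) (ct _)).
exact: continuous_stereo_inv.
Qed.

Lemma sphere_connected : connected [set: S].
Proof.
have -> : [set: S] = stereo_dom 1 `|` stereo_dom (-1).
  by apply/seteqP; split => // p _; exact: stereo_cover.
apply: connectedU; [|exact/stereo_dom_connected/expr1n|exact/stereo_dom_connected/sqrrN1].
exists (stereo_inv (expr1n R 2) (1 +i* 0)%C); split; first exact: stereo_inv_dom.
by rewrite /stereo_dom /= !mxE /= /sqnorm /= !mulr0 addr0 !mulr1 subrr mulr0 mul0r mulr0.
Qed.

Lemma sphere_chart (p : S) : exists (U : set S) (phi : S -> R[i]),
  complex_chart U phi /\ U p.
Proof.
have [h|h] := stereo_cover p.
  by exists (stereo_dom 1), (stereo 1); split => //; exact/stereo_chart/expr1n.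
by exists (stereo_dom (-1)), (stereo (-1)); split => //; exact/stereo_chart/sqrrN1.
Qed.

Lemma sphere_nonempty : [set: S] !=set0.
Proof. by exists (stereo_inv (expr1n R 2) 0). Qed.

End sphere.

Definition sphere (R : realType) : closed_surface R :=
  @ClosedSurface R (set_type (unit_sphere R)) sphere_nonempty sphere_hausdorff
    sphere_compact sphere_connected sphere_chart.

(* Main.v *)
Require Import Defs.
From HB Require Import structures.
From mathcomp Require Import all_boot all_order all_algebra.
From mathcomp Require Import all_classical all_reals all_analysis.
From mathcomp Require Import complex.
From mathcomp Require Import separable ring lra.

(* Let [a] and [b] be the first two points.  Send [a] to infinity and [b] to  *)
(* [0] by a homeomorphism [m] of the sphere minus [a] with the plane.  Since  *)
(* all local degrees over [a] and [b] are even, [m o f] has a continuous      *)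
(* square root near every point of the covering sphere, also in a punctured   *)
(* neighbourhood of each point over [a] or [b].  The sphere being simply      *)
(* connected, these glue to a global root [G]: first over rectangles of a     *)
(* stereographic plane, by real induction, then over both planes, whose       *)
(* overlap is connected.  For [w] nonzero, the number of points of [G = w],   *)
(* counted with local degrees, is locally constant, hence a constant [c] as   *)
(* the punctured plane is connected.  The fibre over the point of coordinate  *)
(* [w ^ 2] is the disjoint union of [G = w] and [G = - w], so [2 c = d] and   *)
(* every such fibre splits into two parts of weight [d / 2].                  *)

Set Implicit Arguments.
Unset Strict Implicit.
Unset Printing Implicit Defensive.

Import Order.TTheory GRing.Theory Num.Theory numFieldNormedType.Exports.

Local Open Scope classical_set_scope.
Local Open Scope ring_scope.

(** * Connected sets in the plane *)

(** Around a point of even local degree over [a] or [b], the argument of [m o f] changes by an even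
    number of turns, so a square root of [m o f] has no monodromy there. The covering sphere has no
    other loops to obstruct it, hence the root [G] is global. Over a third point [y] of coordinate
    [w ^ 2], the fibre is cut in two by the sign in [G = w] or [G = - w]. Each part has weight
    [d / 2], because the weighted number of solutions of [G = w] is the same for all nonzero [w], in
    particular for [w] and [- w].

    Roots exist locally by [local_branch] off the zeros and by [even_has_branch], through
    [even_branch_near], at the points over [a] and [b]. They are unique up to one global sign on
    connected open sets, by [branch_agree]; this is what glues them in [box_has_branch] and
    [sphere_has_branch], and [covering_square_root] is the outcome. On the counting side,
    [local_degree_count] and [near_fiber] describe in [fiber_count] how a fibre deforms, and
    [eventually_constant] turns this into constancy in [fiber_halves]. *)

Section plane_topology.
Context {R : realType}.
Local Notation C := R[i].
Local Notation re := (@complex.Re R).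
Local Notation im := (@complex.Im R).

Lemma eq_complex_coord (z w : C) : re z = re w -> im z = im w -> z = w.
Proof. by case: z w => ? ? [? ?] /= -> ->. Qed.

Definition square (z : C) (r : R) : set C :=
  [set w | `|re w - re z| < r /\ `|im w - im z| < r].

Lemma square_nbhs (z : C) (r : R) : 0 < r -> \forall w \near z, square z r w.
Proof.
move=> r0; have r0C : 0 < (r%:C)%C by rewrite ltcR.
have nb : nbhs z (ball z (r%:C)%C) by exact: nbhsx_ballx.
apply: filterS nb => w; rewrite -ball_normE /= => /normc_coord_le[].
by rewrite !raddfB /= => h1 h2; split; rewrite distrC.
Qed.

Lemma nbhs_squareP (z : C) (A : set C) :
  nbhs z A -> exists2 r : R, 0 < r & forall w, square z r w -> A w.
Proof.
move=> /nbhs_ballP[[e e'] /=]; rewrite ltcE /= => /andP[/eqP -> e0] h.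
exists (e / 2); first by rewrite divr_gt0.
move=> w [h1 h2]; apply: h; rewrite -ball_normE /=.
have -> : z - w = (re (z - w) +i* im (z - w))%C by case: (z - w).
apply: le_lt_trans (normc_le_coord _ _) _.
by rewrite ltcR !raddfB/= distrC (distrC (im z)); lra.
Qed.

(** The plane has no isolated point. This provides a single point at which several conditions on
    punctured neighbourhoods hold together. *)
Lemma punctured_nbhs (z : C) (A : set C) :
  nbhs z A -> exists2 w, w != z & A w.
Proof.
move=> /nbhs_squareP[r r0 h]; exists ((re z + r / 2) +i* im z)%C.
  apply/eqP => /(congr1 re) /=; lra.
by apply: h; split => /=; rewrite ?subrr ?normr0// ltr_norml; apply/andP; lra.
Qed.

Lemma open_neq (X : topologicalType) (x : X) : hausdorff_space X -> open [set y | y != x].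
Proof.
move=> hX; rewrite (_ : [set _ | _] = ~` [set x]); last by apply/seteqP; split => w /= /eqP.
by apply: closed_openC; exact: accessible_closed_set1 (hausdorff_accessible hX) _.
Qed.

Lemma open_punctured (X : topologicalType) (U : set X) (x : X) :
  hausdorff_space X -> open U -> open (U `\ x).
Proof.
move=> hX oU; rewrite setDE; apply: openI => //.
rewrite (_ : ~` [set x] = [set y | y != x]); first exact: open_neq.
by apply/seteqP; split => w /= /eqP.
Qed.

(** The level set of the value [b x] is open in [U], and so is its complement in [U]. *)
Lemma connected_locally_constant (X : topologicalType) T (b : X -> T) (U : set X) :
  open U -> connected U -> (forall x, U x -> \forall y \near x, b y = b x) ->
  forall x y, U x -> U y -> b x = b y.
Proof.
move=> oU cU lb x y Ux Uy; pose B := [set u | U u /\ b u = b x].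
suff : B = U by move=> BU; have [_ ->] : B y by rewrite BU.
apply: cU; first by exists x.
- exists B => //; last by apply/seteqP; split => [u []|u []].
  rewrite openE => u [Uu bu]; rewrite /interior.
  have nU : nbhs u U by exact: open_nbhs_nbhs.
  by apply: filterS2 nU (lb u Uu) => v Uv e; split => //; rewrite e.
- exists (~` [set u | U u /\ b u <> b x]).
    apply: open_closedC; rewrite openE => u [Uu bu]; rewrite /interior.
    have nU : nbhs u U by exact: open_nbhs_nbhs.
    by apply: filterS2 nU (lb u Uu) => v Uv e; split => //; rewrite e.
  apply/seteqP; split => u; first by case=> Uu bu; split => // -[_]; exact.
  by case=> Uu /not_andP[//|/contrapT].
Qed.

(** The value that [s] takes around a point, rather than at it, is locally constant. This serves to
    compare two roots across isolated zeros, and fibre counts across values with multiple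
    preimages. *)
Lemma eventually_constant T (s : C -> T) (U : set C) :
  open U -> connected U ->
  (forall z, U z -> exists c, \forall w \near z, w != z -> s w = c) ->
  exists c, forall z, U z -> \forall w \near z, w != z -> s w = c.
Proof.
move=> oU cU ls.
have /choice[b bP] : forall z, exists c, U z -> \forall w \near z, w != z -> s w = c.
  move=> z; case: (pselect (U z)) => [/ls[c ?]|?]; first by exists c.
  by exists (s 0).
suff bc x y : U x -> U y -> b x = b y.
  case: (pselect (exists z, U z)) => [[z Uz]|nU].
    by exists (b z) => x Ux; rewrite (bc _ _ Uz Ux); exact: bP.
  by exists (s 0) => z Uz; exfalso; apply: nU; exists z.
apply: connected_locally_constant => // {x y} x Ux.
have [A /= [oA Ax] hA] : exists2 A, open_nbhs x A & forall y, A y -> U y /\ (y != x -> s y = b x).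
  have nU : nbhs x U by exact: open_nbhs_nbhs.
  have : nbhs x [set y | U y /\ (y != x -> s y = b x)].
    by apply: filterS2 nU (bP x Ux).
  by rewrite nbhsE /= => -[A oA sA]; exists A.
have nA : nbhs x A by exact: open_nbhs_nbhs.
apply: filterS nA => y Ay; have [->//|yx] := eqVneq y x.
have [Uy sy] := hA y Ay.
have n1 : nbhs y A by exact: open_nbhs_nbhs.
have n2 : \forall w \near y, w != x.
  by apply: open_nbhs_nbhs; split => //; exact: open_neq (@norm_hausdorff _ C).
(* As [w] differs from both [x] and [y], the value [s w] equals [b x] and [b y]. *)
have [w wy [[Aw wx] sw]] := punctured_nbhs (filterI (filterI n1 n2) (bP y Uy)).
by rewrite -(sw wy); case: (hA w Aw) => _; apply.
Qed.

Lemma star_connected (U : set C) (c : C) :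
  (forall z, U z -> forall t : R, 0 <= t <= 1 ->
    U ((re c + t * (re z - re c)) +i* (im c + t * (im z - im c)))%C) ->
  connected U.
Proof.
move=> sU.
pose ray (z : C) (t : R) : C := ((re c + t * (re z - re c)) +i* (im c + t * (im z - im c)))%C.
have -> : U = \bigcup_(z in U) (ray z @` `[0, 1]%classic).
  apply/seteqP; split => [z Uz|_ [z Uz [t t01 <-]]]; last first.
    by apply: sU => //; move: t01; rewrite /= in_itv.
  exists z => //; exists 1; first by rewrite /= in_itv /= ler01 lexx.
  by apply: eq_complex_coord => /=; ring.
apply: bigcup_connected.
  exists c => z Uz; exists 0; first by rewrite /= in_itv /= lexx ler01.
  by apply: eq_complex_coord => /=; ring.
move=> z _; apply: connected_continuous_connected.
  by apply/connected_intervalP; exact: interval_is_interval.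
apply: continuous_subspaceT => t.
have ct (a b : R) : continuous_at t (fun t : R => a + t * b).
  apply: continuousDf; first exact: continuous_cstf.
  by apply: continuousMf; [exact: cvg_id|exact: continuous_cstf].
exact: (cvg_complex _ (ct _ _) (ct _ _)).
Qed.

Definition box (I J : set R) : set C := [set z | I (re z) /\ J (im z)].

Lemma box_open (I J : set R) : open I -> open J -> open (box I J).
Proof.
move=> oI oJ; rewrite (_ : box I J = (re @^-1` I) `&` (im @^-1` J))//.
apply: openI; apply: open_comp => // z _.
- exact: continuous_Re.
- exact: continuous_Im.
Qed.

Lemma box_connected (I J : set R) :
  is_interval I -> is_interval J -> connected (box I J).
Proof.
move=> iI iJ; case: (pselect (exists z, box I J z)) => [[c [Ic Jc]]|n]; last first.
  rewrite (_ : box I J = set0); first exact: connected0.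
  by apply/seteqP; split => // z h; apply: n; exists z.
have seg (K : set R) a b t : is_interval K -> K a -> K b -> 0 <= t <= 1 ->
    K (a + t * (b - a)).
  move=> iK Ka Kb t01; have [ab|ba] := leP a b.
    by apply: (iK a b) => //; apply/andP; split; nra.
  by apply: (iK b a) => //; apply/andP; split; nra.
by apply: (@star_connected _ c) => z [Iz Jz] t t01; split => /=; exact: seg.
Qed.

Lemma boxI (I J I' J' : set R) : box I J `&` box I' J' = box (I `&` I') (J `&` J').
Proof. by apply/seteqP; split => z [[? ?] [? ?]]. Qed.

Lemma is_intervalI (I J : set R) : is_interval I -> is_interval J -> is_interval (I `&` J).
Proof. by move=> iI iJ x y [? ?] [? ?] z h; split; [exact: (iI x y)|exact: (iJ x y)]. Qed.

(** The punctured box is the union of its right, upper, left and lower open halves, each a box.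
    Right meets upper at [(r, r)], left meets lower at [(- r, - r)], and the two unions meet at
    [(r, - r)]. *)
Lemma punctured_box_connected (I J : set R) : open I -> open J ->
  is_interval I -> is_interval J -> I 0 -> J 0 -> connected (box I J `\ 0).
Proof.
move=> oI oJ iI iJ I0 J0.
have ipos : is_interval [set x : R | 0 < x].
  by move=> x y /= x0 y0 z; lra.
have ineg : is_interval [set x : R | x < 0].
  by move=> x y /= x0 y0 z; lra.
have near0 (K : set R) : open K -> K 0 -> exists2 e, 0 < e & forall x, `|x| < e -> K x.
  move=> oK K0; have /nbhs_ballP[e /= e0 h] : nbhs (0 : R) K by exact: open_nbhs_nbhs.
  by exists e => // x xe; apply: h; rewrite -ball_normE /= sub0r normrN.
have [e e0 eI] := near0 _ oI I0; have [e' e'0 eJ] := near0 _ oJ J0.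
pose r := Num.min e e' / 2.
have [r0 re1 re2] : [/\ 0 < r, r < e & r < e'].
  by rewrite /r; case: (leP e e') => ?; split; lra.
have Ir : I r /\ I (- r) by split; apply: eI; rewrite ?normrN gtr0_norm.
have Jr : J r /\ J (- r) by split; apply: eJ; rewrite ?normrN gtr0_norm.
pose P := [set x : R | 0 < x]; pose N := [set x : R | x < 0].
have -> : box I J `\ 0 = ((box (I `&` P) J `|` box I (J `&` P)) `|`
            (box (I `&` N) J `|` box I (J `&` N))).
  apply/seteqP; split => [z [[Iz Jz] /eqP z0]|z]; last first.
    by move=> [[[[? h] ?]|[? [? h]]]|[[[? h] ?]|[? [? h]]]]; split => //= z0;
      move: h; rewrite z0 /P /N /= ltxx.
  have [h|h|h] := ltgtP (re z) 0; first by right; left.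
    by left; left.
  have [h'|h'|h'] := ltgtP (im z) 0; first by right; right.
    by left; right.
  by case/negP: z0; apply/eqP/eq_complex_coord.
apply: connectedU; [exists (r +i* (- r))%C| |].
- by split; [left|right]; split => //=; case: Ir; case: Jr => //; split => //; rewrite /N /=; lra.
- apply: connectedU; [exists (r +i* r)%C| |].
  + by case: Ir; case: Jr.
  + by apply: box_connected => //; exact: is_intervalI.
  + by apply: box_connected => //; exact: is_intervalI.
- apply: connectedU; [exists ((- r) +i* (- r))%C| |].
  + by case: Ir => ? ?; case: Jr => ? ?; split; split => //=; split => //; rewrite /N /=; lra.
  + by apply: box_connected => //; exact: is_intervalI.
  + by apply: box_connected => //; exact: is_intervalI.
Qed.

Lemma itvoo_is_interval (a b : R) : is_interval [set x | a < x < b].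
Proof. by move=> x y /= ? ? z; lra. Qed.

Lemma itvoo_open (a b : R) : open [set x | a < x < b].
Proof.
rewrite (_ : [set x | _] = `]a, b[%classic); first exact: interval_open.
by apply/seteqP; split => x; rewrite /= in_itv.
Qed.

Lemma punctured_square_connected (z : C) (r : R) : 0 < r ->
  connected (square z r `\ z).
Proof.
move=> r0; pose I := [set x : R | - r < x < r].
have cB : connected (box I I `\ 0).
  by apply: punctured_box_connected;
    (exact: itvoo_open) || (exact: itvoo_is_interval) || (rewrite /I /=; lra).
rewrite (_ : square z r `\ z = (fun w => w + z) @` (box I I `\ 0)).
  apply: connected_continuous_connected cB _; apply: continuous_subspaceT => w.
  exact: (continuousD cvg_id (cvg_cst _)).
apply/seteqP; split => [w [[h1 h2] wz]|_ [w [[h1 h2] wz] <-]].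
  exists (w - z); last by rewrite subrK.
  split; last by move=> /eqP; rewrite subr_eq0 => /eqP.
  by move: h1 h2; rewrite !ltr_norml; split; rewrite /I /= raddfB.
split; last by move=> /eqP; rewrite -subr_eq0 addrK => /eqP.
by split; rewrite /= raddfD /= addrK ltr_norml.
Qed.

Lemma square_open (z : C) (r : R) : open (square z r).
Proof.
rewrite (_ : square z r = box [set x | re z - r < x < re z + r] [set x | im z - r < x < im z + r]).
  by apply: box_open; exact: itvoo_open.
by apply/seteqP; split => w [h1 h2]; split; move: h1 h2; rewrite /= !ltr_norml; lra.
Qed.

End plane_topology.

(** * Continuous square roots *)

Section square_roots.
Context {R : realType}.
Local Notation C := R[i].
Local Notation re := (@complex.Re R).
Local Notation im := (@complex.Im R).

Lemma continuous_at_eq (X Y : topologicalType) (f g : X -> Y) (x : X) :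
  (\forall y \near x, f y = g y) -> continuous_at x f -> continuous_at x g.
Proof.
move=> fg cf; rewrite /continuous_at -(nbhs_singleton fg).
by apply: cvg_trans cf; apply: near_eq_cvg; apply: filterS fg.
Qed.

Lemma continuous_at_cst (X Y : topologicalType) (c : Y) (x : X) :
  continuous_at x (fun=> c).
Proof. exact: cvg_cst. Qed.

Lemma continuous_neq (X : topologicalType) (f : X -> C) (c : C) (x : X) :
  continuous_at x f -> f x != c -> \forall y \near x, f y != c.
Proof.
move=> cf fx; have := open_neq c (@norm_hausdorff _ C) => o.
by apply: (cf [set y | y != c]); apply: open_nbhs_nbhs.
Qed.

(* The zeros of [F] are points where nothing is required of the root: they are *)
(* meant to be isolated, and the monodromy around them trivial.               *)
Definition branch (X : topologicalType) (F : X -> C) (O : set X) (g : X -> C) : Prop :=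
  forall x, O x -> F x != 0 -> g x ^+ 2 = F x /\ continuous_at x g.

Definition has_branch (X : topologicalType) (F : X -> C) (O : set X) : Prop :=
  exists g, branch F O g.

(** Continuity is asked only off the zeros, so that a pole may be recorded as a zero by giving [F]
    the value 0 there. *)
Definition tame (F : C -> C) (O : set C) : Prop :=
  forall z, O z -> (F z != 0 -> continuous_at z F) /\
    \forall w \near z, w != z -> F w != 0.

Lemma branchS (X : topologicalType) (F : X -> C) (O O' : set X) g :
  O `<=` O' -> branch F O' g -> branch F O g.
Proof. by move=> s b x /s; exact: b. Qed.

Lemma has_branchS (X : topologicalType) (F : X -> C) (O O' : set X) :
  O `<=` O' -> has_branch F O' -> has_branch F O.
Proof. by move=> s [g b]; exists g; exact: branchS b. Qed.

Lemma tameS (F : C -> C) (O O' : set C) : O `<=` O' -> tame F O' -> tame F O.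
Proof. by move=> s t z /s; exact: t. Qed.

Lemma branchN (X : topologicalType) (F : X -> C) (O : set X) g :
  branch F O g -> branch F O (fun x => - g x).
Proof.
move=> b x Ox Fx; have [e c] := b x Ox Fx.
by split; [rewrite sqrrN|exact: (continuousN c)].
Qed.

(** The product of [g - g'] and [g + g'] vanishes, but both factors cannot vanish at [z] since [g z]
    is nonzero. The factor that is nonzero at [z] stays so nearby. *)
Lemma branch_eq_near (F : C -> C) (g g' : C -> C) (O : set C) z :
  open O -> branch F O g -> branch F O g' -> O z -> F z != 0 -> continuous_at z F ->
  \forall w \near z, (g w == g' w) = (g z == g' z).
Proof.
move=> oO b b' Oz Fz cF; have [e c] := b z Oz Fz; have [e' c'] := b' z Oz Fz.
have gz0 : g z != 0 by apply: contra_neq Fz => gz; rewrite -e gz expr0n.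
have nO : nbhs z O by exact: open_nbhs_nbhs.
have nF := continuous_neq cF Fz.
have [gg|gg] := eqVneq (g z) (g' z).
  have cs : continuous_at z (fun w => g w + g' w) by exact: (continuousD c c').
  have s0 : g z + g' z != 0 by rewrite -gg -mulr2n -mulr_natr mulf_neq0 ?pnatr_eq0.
  apply: filterS3 nO nF (continuous_neq cs s0) => w Ow Fw sw.
  have [ew _] := b w Ow Fw; have [ew' _] := b' w Ow Fw.
  have /eqP : (g w - g' w) * (g w + g' w) = 0 by rewrite -subr_sqr ew ew' subrr.
  by rewrite mulf_eq0 (negbTE sw) orbF subr_eq0.
have cs : continuous_at z (fun w => g w - g' w) by exact: (continuousB c c').
have s0 : g z - g' z != 0 by rewrite subr_eq0.
by apply: filterS (continuous_neq cs s0) => w; rewrite subr_eq0 => /negbTE.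
Qed.

(** Whether [g = g'] holds is locally constant off the zeros of [F]. A small punctured square around
    a zero is connected, so the answer does not change across it, and [eventually_constant] spreads
    it over [O]. *)
Lemma branch_agree (F : C -> C) (O : set C) g g' :
  open O -> connected O -> tame F O -> branch F O g -> branch F O g' ->
  (forall z, O z -> F z != 0 -> g z = g' z) \/
  (forall z, O z -> F z != 0 -> g z = - g' z).
Proof.
move=> oO cO tF b b'.
have [c hc] : exists c, forall z, O z -> \forall w \near z, w != z -> (g w == g' w) = c.
  apply: eventually_constant => // z Oz.
  have [_ tz] := tF z Oz.
  have nO : nbhs z O by exact: open_nbhs_nbhs.
  have [r r0 hr] := nbhs_squareP (filterI nO tz).
  have oS : open (square z r `\ z).
    by apply: open_punctured; [exact: norm_hausdorff|exact: square_open].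
  have lc x : (square z r `\ z) x -> \forall y \near x, (g y == g' y) = (g x == g' x).
    move=> [/hr[Ox Fx] /eqP /Fx Fx0].
    exact: branch_eq_near oO b b' Ox Fx0 ((tF x Ox).1 Fx0).
  have lc' := connected_locally_constant oS (@punctured_square_connected _ z _ r0) lc.
  have nS := @square_nbhs _ z _ r0.
  have [u uz Su] := punctured_nbhs nS.
  exists (g u == g' u); apply: filterS nS => w Sw wz.
  by apply: lc'; split => //; apply/eqP.
have hc' z : O z -> F z != 0 -> (g z == g' z) = c.
  move=> Oz Fz.
  have h := branch_eq_near oO b b' Oz Fz ((tF z Oz).1 Fz).
  by have [w wz [<- hw]] := punctured_nbhs (filterI h (hc z Oz)); exact: hw.
case: c hc' {hc} => hc; [left|right] => z Oz Fz; first by apply/eqP; rewrite hc.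
have [e _] := b z Oz Fz; have [e' _] := b' z Oz Fz.
have /eqP : g z ^+ 2 = g' z ^+ 2 by rewrite e e'.
by rewrite eqf_sqr hc//= => /eqP.
Qed.

Lemma branch_glue (X : topologicalType) (F : X -> C) (O1 O2 : set X) g1 g2 :
  open O1 -> open O2 -> (forall x, O2 x -> F x != 0 -> continuous_at x F) ->
  branch F O1 g1 -> branch F O2 g2 ->
  (forall x, O1 x -> O2 x -> F x != 0 -> g1 x = g2 x) ->
  branch F (O1 `|` O2) (fun x => if x \in O1 then g1 x else g2 x).
Proof.
move=> o1 o2 cF b1 b2 ag x Ox Fx; have [x1|x1] := boolP (x \in O1).
  have O1x := set_mem x1; have [e c] := b1 x O1x Fx; split; first exact: e.
  have nO : nbhs x O1 by exact: open_nbhs_nbhs.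
  by apply: continuous_at_eq c; apply: filterS nO => y /mem_set ->.
have O2x : O2 x by case: Ox => // /mem_set h; rewrite h in x1.
have [e c] := b2 x O2x Fx; split; first exact: e.
have nO : nbhs x O2 by exact: open_nbhs_nbhs.
(* [x] may lie on the boundary of [O1]. Nearby points of [O1] take the value [g1], which is known to
   equal [g2] only where [F] is nonzero. *)
apply: continuous_at_eq c.
apply: filterS2 nO (continuous_neq (cF x O2x Fx) Fx) => y O2y Fy.
by case: ifPn => // /set_mem O1y; rewrite ag.
Qed.

(** On the connected overlap the two roots differ by one sign, which is absorbed into the second
    root. *)
Lemma has_branchU (F : C -> C) (O1 O2 : set C) :
  open O1 -> open O2 -> connected (O1 `&` O2) -> tame F (O1 `|` O2) ->
  has_branch F O1 -> has_branch F O2 -> has_branch F (O1 `|` O2).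
Proof.
move=> o1 o2 c12 t [g1 b1] [g2 b2].
have t12 : tame F (O1 `&` O2) by apply: tameS t => z [? _]; left.
have tF x : O2 x -> F x != 0 -> continuous_at x F by move=> O2x; apply: (t x _).1; right.
have b1' : branch F (O1 `&` O2) g1 by apply: branchS b1 => z [].
have b2' : branch F (O1 `&` O2) g2 by apply: branchS b2 => z [].
have [h|h] := branch_agree (openI o1 o2) c12 t12 b1' b2'.
  by eexists; apply: branch_glue b1 b2 _ => // x O1x O2x; apply: h.
by eexists; apply: branch_glue b1 (branchN b2) _ => // x O1x O2x; apply: h.
Qed.

(* The principal root on the right half plane:                               *)
(* with [t ^ 2 = (|v| + re v) / 2], [(t + i im v / 2t) ^ 2 = v].              *)
Lemma principal_sqrt : exists s : C -> C,
  forall v, 0 < re v -> s v ^+ 2 = v /\ continuous_at v s.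
Proof.
pose t (v : C) : R := Num.sqrt ((Num.sqrt (re v * re v + im v * im v) + re v) / 2).
exists (fun v => (t v +i* (im v / (2 * t v)))%C) => v v0.
have w0 : 0 < (Num.sqrt (re v * re v + im v * im v) + re v) / 2.
  by rewrite divr_gt0// ltr_wpDl// sqrtr_ge0.
have t0 : 0 < t v by rewrite sqrtr_gt0.
split.
  have tt : t v ^+ 2 * 2 - re v = Num.sqrt (re v * re v + im v * im v).
    by rewrite sqr_sqrtr ?ltW//; field.
  have : (t v ^+ 2 * 2 - re v) ^+ 2 = re v * re v + im v * im v.
    by rewrite tt sqr_sqrtr// addr_ge0// -expr2 sqr_ge0.
  move: t0; case: v {v0 w0 tt} => a b /=; set u := t _ => u0 hu.
  have un0 : u != 0 by rewrite gt_eqF.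
  rewrite expr2; apply: eq_complex_coord => /=; last by field.
  have -> : u * u - b / (2 * u) * (b / (2 * u)) = u ^+ 2 - (b * b) / (4 * u ^+ 2) by field.
  have -> : b * b = (u ^+ 2 * 2 - a) ^+ 2 - a * a by rewrite hu; ring.
  by field.
have cn : continuous_at v (fun v : C => Num.sqrt (re v * re v + im v * im v)).
  apply: (@continuous_comp _ _ _ (fun v : C => re v * re v + im v * im v) Num.sqrt);
    last exact: sqrt_continuous.
  by apply: continuousDf; apply: continuousMf; exact: continuous_Re || exact: continuous_Im.
have ct : continuous_at v t.
  apply: (@continuous_comp _ _ _ (fun v : C => (Num.sqrt (re v * re v + im v * im v) + re v) / 2)
    Num.sqrt); last exact: sqrt_continuous.
  apply: continuousMf; last exact: continuous_cstf.
  by apply: continuousDf => //; exact: continuous_Re.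
have ci : continuous_at v (fun v : C => im v / (2 * t v)).
  apply: continuousVf; first by rewrite mulf_neq0// ?pnatr_eq0// gt_eqF.
    exact: continuous_Im.
  by apply: continuousMf ct; exact: continuous_cstf.
exact: (cvg_complex _ ct ci).
Qed.

(** Dividing by [F x] brings the values near 1, into the half plane of the principal root. *)
Lemma local_branch (X : topologicalType) (F : X -> C) (x : X) :
  F x != 0 -> (\forall y \near x, continuous_at y F) ->
  exists g, \forall y \near x, F y != 0 -> g y ^+ 2 = F y /\ continuous_at y g.
Proof.
move=> Fx cF; have [s hs] := principal_sqrt.
exists (fun y => sqrtC (F x) * s (F y / F x)).
have cq y : continuous_at y F -> continuous_at y (fun y => F y / F x).
  by move=> cy; apply: (continuousM cy); exact: cvg_cst.
have nre : \forall y \near x, 0 < re (F y / F x).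
  have cx := cq x (nbhs_singleton cF).
  have crx : continuous_at x (fun y => re (F y / F x)).
    by apply: continuous_comp cx _; exact: continuous_Re.
  apply: (crx [set r | 0 < r]); apply: open_nbhs_nbhs; split; first exact: open_gt.
  by rewrite /= divff//= ltr01.
apply: filterS2 cF nre => y cy /hs[e c] _; split.
  by rewrite exprMn sqrtCK e mulrC divfK.
have cs : continuous_at y (fun y => s (F y / F x)).
  exact: (@continuous_comp _ _ _ (fun y => F y / F x) s y (cq y cy) c).
exact: (@continuousM C X (fun=> sqrtC (F x)) _ y (cvg_cst _) cs).
Qed.

End square_roots.

(** * Square roots over rectangles *)

Section box_branches.
Context {R : realType}.
Local Notation C := R[i].
Local Notation re := (@complex.Re R).
Local Notation im := (@complex.Im R).

(** Real induction on the supremum [s] of the [t] with [P a t]: locality at [s] carries an interval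
    ending just before [s] beyond it, unless [s] is already [b]. *)
Lemma interval_induction (P : R -> R -> Prop) (a b : R) : a <= b ->
  (forall x, a <= x <= b -> exists2 e, 0 < e &
     forall u v, x - e < u -> u <= v -> v < x + e -> P u v) ->
  (forall u v w, u <= v -> v <= w -> P u v -> P v w -> P u w) ->
  P a b.
Proof.
move=> ab loc glue; pose A := [set t | a <= t <= b /\ P a t].
have Aa : A a.
  split; first by rewrite lexx ab.
  by have [|e e0 h] := loc a _; [rewrite lexx ab|apply: h => //; lra].
have supA : has_sup A.
  by split; [exists a|exists b => t [/andP[]]].
pose s := sup A.
have as_ : a <= s by exact: (ub_le_sup supA.2).
have sb : s <= b by apply: (ge_sup supA.1) => t [/andP[]].
have [|e e0 h] := loc s _; first by rewrite as_ sb.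
have [t At st] := sup_adherent e0 supA; rewrite -/s in st.
have ts : t <= s by exact: (ub_le_sup supA.2).
(* A point beyond [s], cut at [b]. It will be shown to lie in [A], hence not to exceed [s], which
   forces [s' = b]. *)
pose s' := Num.min b (s + e / 2).
have [s'b ss' s'e] : [/\ s' <= b, s <= s' & s' < s + e].
  by rewrite /s'; case: (leP b (s + e / 2)) => ?; split; lra.
have [/andP[a_t tb] Pt] := At.
have Ps' : P a s' by apply: (glue a t s') => //; [lra|apply: h => //; lra].
have s's : s' <= s by apply: (ub_le_sup supA.2); split => //; lra.
suff -> : b = s' by [].
by move: s's; rewrite /s'; case: (leP b (s + e / 2)) => //; lra.
Qed.

(** The open [e]-neighbourhood of a closed interval, possibly reduced to a point: intervals with a
    common endpoint then overlap in an open interval. *)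
Definition thick (a b e : R) : set R := [set x | a - e < x < b + e].

Lemma thick_union (u v w e : R) : u <= v -> v <= w -> 0 < e ->
  thick u w e = thick u v e `|` thick v w e.
Proof.
move=> uv vw e0; apply/seteqP; split => x; rewrite /thick /=; last by lra.
by have [h|h] := ltP x (v + e); [left|right]; lra.
Qed.

Lemma thickS (u v e e' : R) : e <= e' -> thick u v e `<=` thick u v e'.
Proof. by move=> ee x; rewrite /thick /=; lra. Qed.

Lemma boxS (I J I' J' : set R) : I `<=` I' -> J `<=` J' -> box I J `<=` box I' J'.
Proof. by move=> s s' z [/s ? /s' ?]. Qed.

(** Two boxes meet in a box, so the overlap is connected and [has_branchU] applies. *)
Lemma box_glue (F : C -> C) (I1 J1 I2 J2 : set R) (B : set C) :
  open I1 -> open J1 -> open I2 -> open J2 ->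
  is_interval I1 -> is_interval J1 -> is_interval I2 -> is_interval J2 ->
  box I1 J1 `|` box I2 J2 = B -> tame F B ->
  has_branch F (box I1 J1) -> has_branch F (box I2 J2) -> has_branch F B.
Proof.
move=> oI1 oJ1 oI2 oJ2 iI1 iJ1 iI2 iJ2 <- t b1 b2.
apply: has_branchU => //; try exact: box_open.
by rewrite boxI; apply: box_connected; exact: is_intervalI.
Qed.

Definition branch_near (X : topologicalType) (F : X -> C) (x : X) : Prop :=
  exists g, \forall y \near x, F y != 0 -> g y ^+ 2 = F y /\ continuous_at y g.

Section box_branch.
Variables (F : C -> C) (I J : set R).
Hypotheses (oI : open I) (oJ : open J) (iI : is_interval I) (iJ : is_interval J).
Hypotheses (tF : tame F (box I J)) (lF : forall z, box I J z -> branch_near F z).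

Let good (a b c d : R) : Prop := exists e, [/\ 0 < e,
  box (thick a b e) (thick c d e) `<=` box I J
  & has_branch F (box (thick a b e) (thick c d e))].

Lemma good_point (x y : R) : I x -> J y -> exists2 e, 0 < e & forall u v,
  y - e < u -> u <= v -> v < y + e -> good x x u v.
Proof.
move=> Ix Jy; have Bz : box I J (x +i* y)%C by [].
have [g hg] := lF Bz.
have nB : nbhs (x +i* y)%C (box I J) by apply: open_nbhs_nbhs; split => //; exact: box_open.
have [r r0 h] := nbhs_squareP (filterI hg nB).
exists (r / 2); first by rewrite divr_gt0.
move=> u v yu uv vy; exists (r / 2).
have S : box (thick x x (r / 2)) (thick u v (r / 2)) `<=` square (x +i* y)%C r.
  by move=> w [h1 h2]; move: h1 h2; rewrite /thick /square /= !ltr_norml; lra.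
split; [by rewrite divr_gt0|by move=> w /S/h[]|].
by exists g => w /S/h[].
Qed.

Lemma good_shrink a b c d e e' : 0 < e' -> e' <= e ->
  box (thick a b e) (thick c d e) `<=` box I J /\
    has_branch F (box (thick a b e) (thick c d e)) ->
  box (thick a b e') (thick c d e') `<=` box I J /\
    has_branch F (box (thick a b e') (thick c d e')).
Proof.
move=> e'0 ee [S br].
have S' : box (thick a b e') (thick c d e') `<=` box (thick a b e) (thick c d e).
  by apply: boxS; exact: thickS.
by split; [apply: subset_trans S|exact: has_branchS br].
Qed.

(** Induction on the height of a rectangle of width 0: points give short columns, and stacked
    columns are glued along their margins. *)
Lemma good_column (x c d : R) : I x -> c <= d -> J c -> J d -> good x x c d.
Proof.
move=> Ix cd Jc Jd; apply: (@interval_induction (good x x) c d) => //.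
  by move=> y cyd; apply: good_point => //; exact: (iJ Jc Jd).
move=> u v w uv vw [e1 [e10 S1 b1]] [e2 [e20 S2 b2]].
pose e := Num.min e1 e2.
have [e0 ee1 ee2] : [/\ 0 < e, e <= e1 & e <= e2].
  by rewrite /e; case: (leP e1 e2) => ?; split; lra.
have [S1' b1'] := good_shrink e0 ee1 (conj S1 b1).
have [S2' b2'] := good_shrink e0 ee2 (conj S2 b2).
have U : box (thick x x e) (thick u v e) `|` box (thick x x e) (thick v w e) =
    box (thick x x e) (thick u w e).
  rewrite (thick_union uv vw e0); apply/seteqP; split => z.
    by case=> -[? ?]; split => //; [left|right].
  by case=> ? [?|?]; [left|right].
have S : box (thick x x e) (thick u w e) `<=` box I J.
  by rewrite -U => z [/S1'|/S2'].
exists e; split => //.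
apply: (box_glue _ _ _ _ _ _ _ _ U) => //; try exact: itvoo_open;
  try exact: itvoo_is_interval.
exact: tameS tF.
Qed.

(** Induction on the width, with columns as the local pieces: the margin of the column at [x]
    contains every sufficiently narrow rectangle around it. *)
Lemma good_rectangle (a b c d : R) : a <= b -> c <= d -> I a -> I b -> J c -> J d ->
  good a b c d.
Proof.
move=> ab cd Ia Ib Jc Jd.
apply: (@interval_induction (fun a b => good a b c d) a b) => //.
  move=> x axb; have Ix : I x by exact: (iI Ia Ib).
  have [e [e0 S br]] := good_column Ix cd Jc Jd.
  (* Half of the margin of the column pays for the distance of [u] and [v] from [x], the other half
     is the margin of the new rectangle. *)
  exists (e / 2); first by rewrite divr_gt0.
  move=> u v xu uv vx; exists (e / 2).
  have S' : box (thick u v (e / 2)) (thick c d (e / 2)) `<=` box (thick x x e) (thick c d e).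
    by apply: boxS => t; rewrite /thick /=; lra.
  by split; [rewrite divr_gt0|exact: subset_trans S|exact: has_branchS br].
move=> u v w uv vw [e1 [e10 S1 b1]] [e2 [e20 S2 b2]].
pose e := Num.min e1 e2.
have [e0 ee1 ee2] : [/\ 0 < e, e <= e1 & e <= e2].
  by rewrite /e; case: (leP e1 e2) => ?; split; lra.
have [S1' b1'] := good_shrink e0 ee1 (conj S1 b1).
have [S2' b2'] := good_shrink e0 ee2 (conj S2 b2).
have U : box (thick u v e) (thick c d e) `|` box (thick v w e) (thick c d e) =
    box (thick u w e) (thick c d e).
  rewrite (thick_union uv vw e0); apply/seteqP; split => z.
    by case=> -[? ?]; split => //; [left|right].
  by case=> -[?|?] ?; [left|right].
have S : box (thick u w e) (thick c d e) `<=` box I J.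
  by rewrite -U => z [/S1'|/S2'].
exists e; split => //.
apply: (box_glue _ _ _ _ _ _ _ _ U) => //; try exact: itvoo_open;
  try exact: itvoo_is_interval.
exact: tameS tF.
Qed.

(* Every point shares a good rectangle with a base point [q]; the branches    *)
(* normalised at [q] agree because two rectangles meet in a connected set.    *)
Theorem box_has_branch : has_branch F (box I J).
Proof.
case: (pselect (exists z, box I J z)) => [[z0 Bz0]|n]; last first.
  by exists id => z Bz; exfalso; apply: n; exists z.
have oB : open (box I J) by exact: box_open.
have nB : nbhs z0 (box I J) by exact: open_nbhs_nbhs.
(* Zeros of [F] are isolated, so a base point with [F q] nonzero exists. There the two roots are
   distinct and a value selects one of them. *)
have [q qz0 [[Iq Jq] Fq']] := punctured_nbhs (filterI nB (tF Bz0).2).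
have Fq := Fq' qz0.
have ex z : exists Kg : (set R * set R) * (C -> C), box I J z ->
    [/\ [/\ open Kg.1.1, open Kg.1.2, is_interval Kg.1.1 & is_interval Kg.1.2],
       box Kg.1.1 Kg.1.2 q, box Kg.1.1 Kg.1.2 z, box Kg.1.1 Kg.1.2 `<=` box I J
     & branch F (box Kg.1.1 Kg.1.2) Kg.2 /\ Kg.2 q = sqrtC (F q)].
  case: (pselect (box I J z)) => [[Iz Jz]|]; last by exists ((setT, setT), id).
  have mM (K : set R) a b : K a -> K b ->
      [/\ Num.min a b <= Num.max a b, K (Num.min a b) & K (Num.max a b)].
    by move=> Ka Kb; case: (leP a b) => ?; split => //; lra.
  have [l1 I1 I2] := mM _ _ _ Iq Iz; have [l2 J1 J2] := mM _ _ _ Jq Jz.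
  have [e [e0 S [g bg]]] := good_rectangle l1 l2 I1 I2 J1 J2.
  set I' := thick (Num.min _ _) _ e in S bg; set J' := thick _ _ e in S bg.
  have mt a b : thick (Num.min a b) (Num.max a b) e a /\
      thick (Num.min a b) (Num.max a b) e b.
    by rewrite /thick /=; case: (leP a b) => ?; split; lra.
  have qB : box I' J' q by split; [apply: (mt _ _).1|apply: (mt _ _).1].
  have zB : box I' J' z by split; [apply: (mt _ _).2|apply: (mt _ _).2].
  have oK : [/\ open I', open J', is_interval I' & is_interval J'].
    by split; (exact: itvoo_open) || (exact: itvoo_is_interval).
  have [gq _] := bg q qB Fq.
  have : g q ^+ 2 == (sqrtC (F q)) ^+ 2 by rewrite sqrtCK gq.
  rewrite eqf_sqr => /orP[/eqP|/eqP] e'; first by exists ((I', J'), g).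
  exists ((I', J'), fun z => - g z) => _.
  split; [exact: oK|exact: qB|exact: zB|exact: S|split; first exact: branchN].
  by rewrite /= e' opprK.
have [k hk] := choice ex; clear ex.
exists (fun z => (k z).2 z) => z Bz Fz.
have [[oI1 oJ1 iI1 iJ1] q1 z1 s1 [b1 e1]] := hk z Bz.
have [sq cz] := b1 z z1 Fz; split; first exact: sq.
have n1 : nbhs z (box (k z).1.1 (k z).1.2).
  by apply: open_nbhs_nbhs; split => //; exact: box_open.
have nF := continuous_neq ((tF Bz).1 Fz) Fz.
apply: continuous_at_eq cz; apply: filterS2 n1 nF => w w1 Fw.
have [[oI2 oJ2 iI2 iJ2] q2 w2 s2 [b2 e2]] := hk w (s1 w w1).
pose B := box (k z).1.1 (k z).1.2 `&` box (k w).1.1 (k w).1.2.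
have oB' : open B by apply: openI; exact: box_open.
have cB' : connected B by rewrite /B boxI; apply: box_connected; exact: is_intervalI.
have tB' : tame F B by apply: tameS tF => y [/s1].
have b1' : branch F B (k z).2 by apply: branchS b1 => y [].
have b2' : branch F B (k w).2 by apply: branchS b2 => y [].
have [h|h] := branch_agree oB' cB' tB' b1' b2'; first exact: h.
(* Opposite roots are excluded at [q], where both take the nonzero value [sqrtC (F q)]. *)
have : (k z).2 q = - (k w).2 q by apply: h.
rewrite e1 e2 => /eqP; rewrite -addr_eq0 -mulr2n -mulr_natr mulf_eq0 pnatr_eq0 orbF.
by rewrite sqrtC_eq0 (negbTE Fq).
Qed.

End box_branch.

End box_branches.

(** * Square roots of even functions *)

Section even_functions.
Context {R : realType}.
Local Notation C := R[i].
Local Notation re := (@complex.Re R).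
Local Notation im := (@complex.Im R).

(* [s] and [u] are roots on the right and upper half squares, equal on the     *)
(* first quadrant and with [s z = c * u (- z)] on the fourth; evenness lets    *)
(* [c * s (- z)] and [c * u (- z)] close them up on the other two halves.      *)
Lemma even_has_branch (E : C -> C) (r : R) :
  (forall z, square 0 r z -> z != 0 -> E z != 0 /\ continuous_at z E) ->
  (forall z, square 0 r z -> z != 0 -> E (- z) = E z) ->
  has_branch E (square 0 r `\ 0).
Proof.
move=> hE ev.
pose K := [set x : R | - r < x < r]; pose P := [set x : R | 0 < x < r].
pose N := [set x : R | - r < x < 0].
have oK : open K by exact: itvoo_open.
have oP : open P by exact: itvoo_open.
have oN : open N by exact: itvoo_open.
have iK : is_interval K by exact: itvoo_is_interval.
have iP : is_interval P by exact: itvoo_is_interval.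
have iN : is_interval N by exact: itvoo_is_interval.
have sqE z : square 0 r z <-> K (re z) /\ K (im z).
  by rewrite /square /K /= !subr0 !ltr_norml.
have rP z : box P K z -> square 0 r z /\ z != 0.
  move=> [h1 h2]; split; first by apply/sqE; split => //; move: h1; rewrite /P /K /=; lra.
  by apply/eqP => z0; move: h1; rewrite z0 /P /= ltxx.
have uP z : box K P z -> square 0 r z /\ z != 0.
  move=> [h1 h2]; split; first by apply/sqE; split => //; move: h2; rewrite /P /K /=; lra.
  by apply/eqP => z0; move: h2; rewrite z0 /P /= ltxx.
have E0 z : square 0 r z -> z != 0 -> \forall w \near z, E w != 0.
  by move=> Sz z0; have [? c] := hE z Sz z0; exact: continuous_neq.
have tS (O : set C) : (forall z, O z -> square 0 r z /\ z != 0) -> tame E O.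
  move=> h z /h[Sz z0]; split => [_|]; first exact: (hE z Sz z0).2.
  by apply: filterS (E0 z Sz z0).
have lS (O : set C) : (forall z, O z -> square 0 r z /\ z != 0) ->
    forall z, O z -> branch_near E z.
  move=> h z /h[Sz z0]; apply: local_branch; first exact: (hE z Sz z0).1.
  have n1 : nbhs z (square 0 r) by apply: open_nbhs_nbhs; split => //; exact: square_open.
  have n2 : nbhs z [set w | w != 0].
    by apply: open_nbhs_nbhs; split => //; exact: open_neq (@norm_hausdorff _ C).
  by apply: filterS2 n1 n2 => w Sw w0; exact: (hE w Sw w0).2.
have [s bs] := box_has_branch oP oK iP iK (tS _ rP) (lS _ rP).
have [u bu] : exists2 u, branch E (box K P) u & forall z, box P P z -> s z = u z.
  have [u bu] := box_has_branch oK oP iK iP (tS _ uP) (lS _ uP).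
  have PPr : box P P `<=` box P K.
    by apply: boxS => // x; rewrite /P /K /=; lra.
  have PPu : box P P `<=` box K P.
    by apply: boxS => // x; rewrite /P /K /=; lra.
  have [h|h] := branch_agree (box_open oP oP) (box_connected iP iP)
      (tS _ (fun z h => rP z (PPr z h))) (branchS PPr bs) (branchS PPu bu).
    by exists u => // z Bz; apply: h => //; have [? ?] := rP z (PPr z Bz); exact: (hE z _ _).1.
  exists (fun z => - u z) => [|z Bz]; first exact: branchN.
  by apply: h => //; have [? ?] := rP z (PPr z Bz); exact: (hE z _ _).1.
move=> su.
have sqN z : square 0 r z -> square 0 r (- z).
  by move=> /sqE; rewrite /K /= => h; apply/sqE; rewrite /K /= !raddfN /=; lra.
have bopp (O : set C) g : (forall z, O z -> square 0 r z /\ z != 0) ->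
    branch E O g -> branch E [set z | O (- z)] (fun z => g (- z)).
  move=> hO b z Oz Ez; have [Sz z0] := hO _ Oz.
  have Eo : E (- z) = E z by rewrite -(ev (- z)) ?opprK.
  have [|e c] := b (- z) Oz; first by rewrite Eo.
  split; first by rewrite e.
  apply: (@continuous_comp _ _ _ (fun z : C => - z) g z _ c).
  exact: (continuousN cvg_id).
have bs' := bopp _ _ rP bs; have bu' := bopp _ _ uP bu.
have PNr : box P N `<=` box P K by apply: boxS => // x; rewrite /N /K /=; lra.
have PNu : box P N `<=` [set z | box K P (- z)].
  by move=> z; rewrite /box /P /N /K /= !raddfN /=; lra.
(* The sign [c] tells whether the root is even or odd: the [g] defined below satisfies
   [g (- z) = c * g z] on the punctured square. *)
have [c [c2 hc]] : exists c : C, c ^+ 2 = 1 /\ forall z, box P N z -> s z = c * u (- z).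
  have [h|h] := branch_agree (box_open oP oN) (box_connected iP iN)
      (tS _ (fun z h => rP z (PNr z h))) (branchS PNr bs) (branchS PNu bu').
    exists 1; rewrite expr1n; split => // z Bz; rewrite mul1r; apply: h => //.
    by have [? ?] := rP z (PNr z Bz); exact: (hE z _ _).1.
  exists (-1); rewrite sqrrN expr1n; split => // z Bz; rewrite mulN1r; apply: h => //.
  by have [? ?] := rP z (PNr z Bz); exact: (hE z _ _).1.
have cc z : c * (c * z) = z by rewrite mulrA -expr2 c2 mul1r.
have bscale (O : set C) g : branch E O g -> branch E O (fun z => c * g z).
  move=> b z Oz Ez; have [e cg] := b z Oz Ez.
  split; first by rewrite exprMn c2 mul1r.
  exact: (continuousM (@continuous_at_cst _ _ c z) cg).
pose g z := if 0 < re z then s z else if 0 < im z then u z else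
  if re z < 0 then c * s (- z) else c * u (- z).
(* On each of the four half squares, which cover the punctured square, [g] is a single branch; its
   continuity follows without any study of the boundaries of the cases. *)
have gr z : box P K z -> g z = s z by rewrite /g => -[/andP[-> _] _].
have gu z : box K P z -> g z = u z.
  rewrite /g => -[/andP[h1 h2] /andP[h3 h4]]; rewrite h3; case: ifP => // z0.
  by apply: su; split; apply/andP.
have gl z : box P K (- z) -> g z = c * s (- z).
  rewrite /g /box /P /K /= !raddfN /= => -[/andP[h1 h2] /andP[h3 h4]].
  have [z0 z0'] : re z < 0 /\ ~~ (0 < re z) by rewrite -leNgt; split; lra.
  rewrite (negbTE z0') z0; case: ifP => [i0|//].
  rewrite (hc (- z)) ?opprK ?cc//.
  by rewrite /box /P /N /= !raddfN /=; lra.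
have gd z : box K P (- z) -> g z = c * u (- z).
  rewrite /g /box /P /K /= !raddfN /= => -[/andP[h1 h2] /andP[h3 h4]].
  case: ifP => [r0|_]; first by apply: hc; rewrite /box /P /N /=; lra.
  have iz : ~~ (0 < im z) by rewrite -leNgt; lra.
  rewrite (negbTE iz).
  case: ifP => [r0|//]; congr (_ * _); apply: su.
  by rewrite /box /P /= !raddfN /=; lra.
have loc (O : set C) g' : open O -> branch E O g' -> (forall z, O z -> g z = g' z) ->
    forall z, O z -> E z != 0 -> g z ^+ 2 = E z /\ continuous_at z g.
  move=> oO b eg z Oz Ez; have [e cg] := b z Oz Ez.
  split; first by rewrite eg.
  have nO : nbhs z O by exact: open_nbhs_nbhs.
  by apply: continuous_at_eq cg; apply: filterS nO => w /eg.
have oopp (O : set C) : open O -> open [set z | O (- z)].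
  move=> oO; apply: (@open_comp _ _ (fun z : C => - z) O) => // z _.
  exact: (continuousN cvg_id).
exists g => z [/sqE[Kr Ki] /eqP z0] Ez.
have [h|h|h] := ltgtP (re z) 0.
- apply: (loc _ _ (oopp _ (box_open oP oK)) (bscale _ _ bs') gl) => //.
  by move: Kr Ki; rewrite /box /P /K /= !raddfN /=; lra.
- apply: (loc _ _ (box_open oP oK) bs gr) => //.
  by move: Kr Ki; rewrite /box /P /K /=; lra.
have [h'|h'|h'] := ltgtP (im z) 0.
- apply: (loc _ _ (oopp _ (box_open oK oP)) (bscale _ _ bu') gd) => //.
  by move: Kr Ki; rewrite /box /P /K /= !raddfN /=; lra.
- apply: (loc _ _ (box_open oK oP) bu gu) => //.
  by move: Kr Ki; rewrite /box /P /K /=; lra.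
by case/eqP: z0; exact: eq_complex_coord.
Qed.

End even_functions.

(** * The sphere minus a point *)

Section sphere_plane.
Context {R : realType}.
Local Notation C := R[i].
Local Notation S := (set_type (unit_sphere R)).
Local Notation i0 := (ord0 : 'I_3).
Local Notation i1 := (lift ord0 ord0 : 'I_3).
Local Notation i2 := (lift ord0 (lift ord0 ord0) : 'I_3).

Definition dot (x y : 'rV[R]_3) : R := x 0 i0 * y 0 i0 + x 0 i1 * y 0 i1 + x 0 i2 * y 0 i2.

(** Orthogonal reflection in the plane normal to [v]. For [v = 0] the subtracted multiple of [v] is
    0, so this is the identity. *)
Definition reflection (v x : 'rV[R]_3) : 'rV[R]_3 := x - (2 * dot x v / dot v v) *: v.

Lemma dot_eq0 v : dot v v = 0 -> v = 0.
Proof.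
rewrite /dot => h; apply/rowP; elim/ord3P; rewrite mxE; apply/eqP;
  rewrite -sqrf_eq0 expr2; apply/eqP; nra.
Qed.

Lemma reflection_sphere v x : unit_sphere R x -> unit_sphere R (reflection v x).
Proof.
rewrite !unit_sphereE !mxE; have [h|h] := eqVneq (dot v v) 0.
  by rewrite (dot_eq0 h) !mxE !mulr0 !subr0.
move: h; rewrite /dot; set k := _ / _; move: (erefl k); rewrite {1}/k.
set q := (X in _ / X) => kE q0 h.
have kq : k * q = 2 * (x 0 i0 * v 0 i0 + x 0 i1 * v 0 i1 + x 0 i2 * v 0 i2).
  by rewrite -kE divfK.
rewrite -[RHS]h; apply/eqP; rewrite -subr_eq0; apply/eqP.
transitivity (k * (k * q - 2 * (x 0 i0 * v 0 i0 + x 0 i1 * v 0 i1 + x 0 i2 * v 0 i2))).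
  by rewrite /q; ring.
by rewrite kq subrr mulr0.
Qed.

Lemma reflectionK v : involutive (reflection v).
Proof.
move=> x; have [h|h] := eqVneq (dot v v) 0.
  by rewrite (dot_eq0 h) /reflection !scaler0 !subr0.
rewrite {1}/reflection.
have -> : dot (reflection v x) v = - dot x v.
  rewrite /reflection; set k := _ / _.
  have kq : k * dot v v = 2 * dot x v by rewrite divfK.
  transitivity (dot x v - k * dot v v); last by rewrite kq; ring.
  by rewrite /dot !mxE; ring.
by rewrite /reflection mulrN mulNr scaleNr opprK subrK.
Qed.

Definition sphere_reflection v (p : S) : S := to_sphere (reflection_sphere v (sphere_valP p)).

Lemma sphere_reflectionK v : involutive (sphere_reflection v).
Proof. by move=> p; apply: sphere_val_inj; rewrite !to_sphereK reflectionK. Qed.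

Lemma continuous_sphere_reflection v : continuous (sphere_reflection v).
Proof.
apply: continuous_to_sphere; apply: continuous_mx => i j p.
have -> : (fun t : S => set_val (sphere_reflection v t) i j) =
    (fun t : S => set_val t 0 j - 2 * dot (set_val t) v / dot v v * v 0 j).
  by apply/funext => t; rewrite (ord1 i) !mxE.
apply: continuousBf; first exact: continuous_sphere_coord.
apply: continuousMf; last exact: continuous_cstf.
apply: continuousMf; last exact: continuous_cstf.
apply: continuousMf; first exact: continuous_cstf.
by rewrite /dot; apply: continuousDf; first apply: continuousDf; apply: continuousMf;
  (exact: continuous_sphere_coord) || (exact: continuous_cstf).
Qed.

Definition north : S := to_sphere (pole_proof (expr1n R 2)).

Lemma stereo_dom_north (p : S) : stereo_dom 1 p <-> p <> north.
Proof.
rewrite /stereo_dom /= mul1r; have := sphere_valP p; rewrite unit_sphereE => h.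
split=> [+ pn|pn]; first by rewrite pn /= mxE /= ltxx.
rewrite ltNge; apply/negP => p1; apply: pn; apply: sphere_val_inj.
have p2 : set_val p 0 i2 = 1 by nra.
have e0 : set_val p 0 i0 ^+ 2 = 0 by nra.
have e1 : set_val p 0 i1 ^+ 2 = 0 by nra.
apply/rowP; elim/ord3P; rewrite !mxE /= ?p2//.
  by apply/eqP; rewrite -sqrf_eq0 e0.
by apply/eqP; rewrite -sqrf_eq0 e1.
Qed.

(** The reflection along the difference of two unit vectors exchanges them: with [v = x - n], the
    number [2 * dot x v] equals [dot v v]. *)
Lemma reflection_north (a : S) : exists v, sphere_reflection v a = north.
Proof.
exists (set_val a - set_val north); apply: sphere_val_inj; rewrite !to_sphereK.
have := sphere_valP a; rewrite unit_sphereE; rewrite /reflection.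
set n := set_val north; set x := set_val a => h.
have [->|xn] := eqVneq x n; first by rewrite subrr scaler0 subr0.
suff -> : 2 * dot x (x - n) / dot (x - n) (x - n) = 1 by rewrite scale1r subKr.
have q0 : dot (x - n) (x - n) != 0.
  by apply/eqP => /dot_eq0/eqP; rewrite subr_eq0 (negbTE xn).
have -> : 2 * dot x (x - n) = dot (x - n) (x - n) by rewrite /dot !mxE /=; lra.
exact: divff.
Qed.

Lemma continuous_at_stereo s (p : S) : stereo_dom s p -> continuous_at p (stereo s).
Proof.
move=> dp; have := @continuous_stereo R s.
by rewrite continuous_open_subspace; [apply; exact: mem_set|exact: stereo_dom_open].
Qed.

(** A reflection takes [a] to the north pole, stereographic projection follows, and a translation
    brings the image of [b] to 0. *)
Lemma sphere_minus_point (a b : S) : b <> a -> exists (m : S -> C) (n : C -> S),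
  [/\ continuous n, forall z, n z <> a /\ m (n z) = z, forall p, p <> a -> n (m p) = p,
      forall p, p <> a -> continuous_at p m & m b = 0].
Proof.
move=> ba; have [v va] := reflection_north a.
pose rho := sphere_reflection v; pose c := stereo 1 (rho b).
have s1 : (1 : R) ^+ 2 = 1 by exact: expr1n.
have rK : involutive rho by exact: sphere_reflectionK.
have dom p : p <> a -> stereo_dom 1 (rho p).
  move=> pa; apply/stereo_dom_north => h; apply: pa.
  by rewrite -(rK p) h -va -/(rho a) rK.
exists (fun p => stereo 1 (rho p) - c), (fun z => rho (stereo_inv s1 (z + c))).
have cr : continuous rho by exact: continuous_sphere_reflection.
split.
- move=> z; apply: (@continuous_comp _ _ _ (fun z => stereo_inv s1 (z + c)) rho); last exact: cr.
  apply: (@continuous_comp _ _ _ (fun z => z + c) (stereo_inv s1)); last exact: continuous_stereo_inv.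
  exact: (continuousD cvg_id (@continuous_at_cst _ _ c z)).
- move=> z; split; last by rewrite rK stereo_invK addrK.
  have /stereo_dom_north h := stereo_inv_dom s1 (z + c).
  by move=> e; apply: h; rewrite -va -e -/(rho _) rK.
- by move=> p /dom h; rewrite subrK stereoK// rK.
- move=> p /dom/continuous_at_stereo h.
  have cs : continuous_at p (fun p => stereo 1 (rho p)).
    by apply: (@continuous_comp _ _ _ rho (stereo 1)) => //; exact: cr.
  exact: (continuousB cs (@continuous_at_cst _ _ c p)).
- by rewrite subrr.
Qed.

End sphere_plane.

(** * Square roots on the sphere *)

Section lifting.
Context {R : realType}.
Local Notation C := R[i].
Local Notation S := (set_type (unit_sphere R)).

Lemma chartP (X : topologicalType) (U : set X) (phi : X -> C) :
  complex_chart U phi -> open U /\ exists (V : set C) (psi : C -> X),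
  [/\ open V, forall x, U x -> V (phi x) /\ psi (phi x) = x,
      forall z, V z -> U (psi z) /\ phi (psi z) = z,
      forall x, U x -> continuous_at x phi & forall z, V z -> continuous_at z psi].
Proof.
move=> [oU [V oV [psi [UV VU K1 K2 [c1 c2]]]]]; split => //.
exists V, psi; split => //.
- by move=> x Ux; split; [exact: UV|exact: K1].
- by move=> z Vz; split; [exact: VU|exact: K2].
- by move=> x Ux; move: c1; rewrite continuous_open_subspace//; apply; exact: mem_set.
- by move=> z Vz; move: c2; rewrite continuous_open_subspace//; apply; exact: mem_set.
Qed.

Lemma near_notin (X : topologicalType) (s : seq X) (x : X) : hausdorff_space X ->
  \forall y \near x, y != x -> y \notin s.
Proof.
move=> hX; elim: s => [|a s IH]; first exact: nearW.
have na : \forall y \near x, y != x -> y != a.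
  have [<-|xa] := eqVneq x a; first exact: nearW.
  have : nbhs x [set y | y != a] by apply: open_nbhs_nbhs; split => //; exact: open_neq.
  by apply: filterS => y.
apply: filterS2 na IH => y h1 h2 yx.
by rewrite inE negb_or h1// h2.
Qed.

Lemma continuous_exp (n : nat) : continuous (fun z : C => z ^+ n).
Proof.
elim: n => [|n IH] z; first exact: continuous_at_cst.
rewrite (_ : (fun z : C => z ^+ n.+1) = (fun z => z * z ^+ n)).
  exact: (continuousM cvg_id (IH z)).
by apply/funext => w; rewrite exprS.
Qed.

Lemma branch_comp (X Y : topologicalType) (F : Y -> C) (h : X -> Y) (U : set X)
    (O : set Y) g :
  (forall x, U x -> O (h x) /\ continuous_at x h) ->
  branch F O g -> branch (F \o h) U (g \o h).
Proof.
move=> hU b x /hU[Ohx ch] Fx; have [e c] := b (h x) Ohx Fx.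
by split; [exact: e|exact: (@continuous_comp _ _ _ h g x ch c)].
Qed.

Lemma eq_branch (X : topologicalType) (F F' : X -> C) (O : set X) g :
  (forall x, O x -> F x = F' x) -> branch F O g -> branch F' O g.
Proof. by move=> FF b x Ox; rewrite -FF// => Fx; exact: b. Qed.

Lemma branch_near_branch (X : topologicalType) (F : X -> C) (x : X) (O : set X) g :
  nbhs x O -> branch F O g -> branch_near F x.
Proof. by move=> nO b; exists g; apply: filterS nO => y; exact: b. Qed.

Lemma near_branch_branch (X : topologicalType) (F : X -> C) (x : X) :
  branch_near F x -> exists O, exists2 g, nbhs x O & branch F O g.
Proof.
move=> [g hg]; exists [set y | F y != 0 -> g y ^+ 2 = F y /\ continuous_at y g], g.
  exact: hg.
by move=> y; exact.
Qed.

(** Near [x], [f] is a power map between two charts. *)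
Lemma local_degree_continuous (X Y : closed_surface R) (f : X -> Y) x k :
  local_degree f x k -> continuous_at x f.
Proof.
move=> [k0 [U [phi [V [psi [/chartP[oU [U' [phi' [oU' h1 h2 c1 c1']]]]
  /chartP[oV [V' [psi' [oV' h3 h4 c2 c2']]]] [Ux x0] [Vx y0] e]]]]]].
have nU : nbhs x U by exact: open_nbhs_nbhs.
have c : continuous_at x (fun u => psi' (phi u ^+ k)).
  apply: (@continuous_comp _ _ _ phi (fun z => psi' (z ^+ k)) x (c1 x Ux)).
  apply: (@continuous_comp _ _ _ (fun z : C => z ^+ k) psi').
    exact: continuous_exp.
  by apply: c2'; rewrite -(e x Ux).2; exact: (h3 _ Vx).1.
apply: continuous_at_eq c; apply: filterS nU => u Uu.
by have [Vu <-] := e u Uu; exact: (h3 _ Vu).2.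
Qed.

(* In the chart [phi], [f] depends on [phi ^ k] only, an even function.       *)
Lemma even_branch_near (X Y : closed_surface R) (f : X -> Y) (F : Y -> C) x k :
  ~~ odd k -> local_degree f x k ->
  (\forall u \near x, u != x -> F (f u) != 0 /\ continuous_at u (F \o f)) ->
  F (f x) = 0 -> branch_near (F \o f) x.
Proof.
move=> ek [k0 [U [phi [V [psi [/chartP[oU [U' [phi' [oU' h1 h2 c1 c1']]]]
  /chartP[oV [V' [psi' [oV' h3 h4 c2 c2']]]] [Ux x0] [Vx y0] e]]]]]] nF Fx0.
have U'0 : U' 0 by rewrite -x0; exact: (h1 _ Ux).1.
have p0 : phi' 0 = x by rewrite -x0; exact: (h1 _ Ux).2.
have nU' : nbhs (0 : C) U' by exact: open_nbhs_nbhs.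
have nF' : nbhs (0 : C) [set z | phi' z != x ->
    F (f (phi' z)) != 0 /\ continuous_at (phi' z) (F \o f)].
  have := c1' 0 U'0; rewrite /continuous_at p0 => c.
  exact: (c _ nF).
have [r r0 hr] := nbhs_squareP (filterI nU' nF').
have px z : square 0 r z -> z != 0 -> phi' z != x.
  move=> /hr[U'z _] z0; apply: contra_neq z0 => e0.
  by rewrite -(h2 z U'z).2 e0.
have [g bg] : has_branch (F \o f \o phi') (square 0 r `\ 0).
  apply: even_has_branch => z Sz z0.
    have [U'z /(_ (px z Sz z0))[F0 cF]] := hr z Sz; split; first exact: F0.
    exact: (@continuous_comp _ _ _ phi' (F \o f) z (c1' z U'z) cF).
  have SNz : square 0 r (- z).
    by move: Sz; rewrite /square /= !subr0 !raddfN /= !normrN.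
  have [Uz ez] := h2 _ (hr _ Sz).1; have [UNz eNz] := h2 _ (hr _ SNz).1.
  have [Vz pz] := e _ Uz; have [VNz pNz] := e _ UNz.
  rewrite /=; congr F.
  rewrite -(h3 _ VNz).2 -(h3 _ Vz).2 pz pNz ez eNz.
  by rewrite exprNn -signr_odd (negbTE ek) expr0 mul1r.
have nS : nbhs x [set u | U u /\ square 0 r (phi u)].
  have := c1 x Ux; rewrite /continuous_at x0 => c.
  have := c _ (square_nbhs 0 r0) => c'.
  have nU : nbhs x U by exact: open_nbhs_nbhs.
  exact: filterI nU c'.
have b : branch (F \o f \o phi' \o phi) ([set u | U u /\ square 0 r (phi u)] `\ x) (g \o phi).
  apply: branch_comp bg => u [[Uu Su] ux]; split; last exact: c1.
  split; first exact: Su.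
  by move=> /= u0; apply: ux; rewrite -(h1 u Uu).2 u0.
exists (g \o phi); apply: filterS nS => u [Uu Su] Fu.
have Fe : F (f u) = (F \o f \o phi' \o phi) u by rewrite /= (h1 u Uu).2.
rewrite /= Fe; apply: b; last by rewrite -Fe.
by split => // ux; move: Fu; rewrite /= ux Fx0 eqxx.
Qed.

(** In the plane of the projection from the north pole, 0 is the south pole, the only point missed
    by the other projection. *)
Lemma stereo_inv_north (z : C) : stereo_dom (-1) (stereo_inv (expr1n R 2) z) <-> z != 0.
Proof.
rewrite /stereo_dom /= to_sphereK !mxE /= mul1r.
have q0 := sqnorm1_neq0 z; have qge0 := sqnorm_ge0 z.
have -> : (-1 * ((sqnorm z - 1) / (sqnorm z + 1)) < 1) = (0 < sqnorm z).
  rewrite mulN1r -mulNr ltr_pdivrMr; last lra.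
  by apply/idP/idP; lra.
rewrite lt_def qge0 andbT; split.
  by apply: contra => /eqP ->; rewrite /sqnorm /= mulr0 addr0.
apply: contra => /eqP h; apply/eqP; move: h; rewrite /sqnorm => h.
by apply: eq_complex_coord => /=; nra.
Qed.

(** Each stereographic plane is a box, hence carries a root. Their overlap, read in the first plane,
    is the punctured plane; being connected, it leaves a single sign to adjust. The finite list [s]
    makes the zeros isolated. *)
Theorem sphere_has_branch (F : S -> C) (s : seq S) :
  (forall p, F p != 0 -> continuous_at p F) ->
  (forall p, F p = 0 -> p \in s /\ branch_near F p) ->
  has_branch F setT.
Proof.
move=> cF zF.
have iT : is_interval [set: R] by [].
have n1 : (1 : R) ^+ 2 = 1 by exact: expr1n.
have tp (t : R) (t1 : t ^+ 2 = 1) : tame (F \o stereo_inv t1) (box setT setT).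
  move=> z _; have c := @continuous_stereo_inv R t t1; split => [Fz|].
    exact: (@continuous_comp _ _ _ (stereo_inv t1) F z (c z) (cF _ Fz)).
  have nz : \forall w \near z, stereo_inv t1 w != stereo_inv t1 z ->
      stereo_inv t1 w \notin s.
    exact: c z _ (near_notin s (stereo_inv t1 z) sphere_hausdorff).
  apply: filterS nz => w h wz; apply/eqP => /zF[ws _].
  have : stereo_inv t1 w != stereo_inv t1 z.
    by apply: contra_neq wz => e; rewrite -(stereo_invK t1 w) e stereo_invK.
  by move=> /h; rewrite ws.
have bp (t : R) (t1 : t ^+ 2 = 1) : has_branch (F \o stereo_inv t1) (box setT setT).
  apply: box_has_branch => //; [exact: openT|exact: openT|] => z _.
  have c := @continuous_stereo_inv R t t1.
  have [W [g nO b]] : exists O, exists2 g, nbhs (stereo_inv t1 z) O & branch F O g.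
    apply: near_branch_branch; have [/zF[]//|F0] := eqVneq (F (stereo_inv t1 z)) 0.
    apply: local_branch => //.
    by apply: filterS (continuous_neq (cF _ F0) F0) => p; exact: cF.
  apply: (@branch_near_branch _ _ _ (stereo_inv t1 @^-1` W) (g \o stereo_inv t1)).
    exact: c.
  by apply: branch_comp b => w Ow; split; [exact: Ow|exact: c].
have bs (t : R) : t ^+ 2 = 1 -> has_branch F (stereo_dom t).
  move=> t1; have [g b] := bp t t1; exists (g \o stereo t).
  apply: (@eq_branch _ ((F \o stereo_inv t1) \o stereo t)).
    by move=> p dp; rewrite /= stereoK.
  by apply: branch_comp b => p dp; split; [|exact: continuous_at_stereo].
have [g1 b1] := bs 1 n1; have [g2 b2] := bs (-1) sqrrN1.
have bi t g : branch F (stereo_dom t) g ->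
    branch (F \o stereo_inv n1) [set z | stereo_dom t (stereo_inv n1 z)] (g \o stereo_inv n1).
  by move=> b; apply: branch_comp b => z Oz; split; [exact: Oz|exact: continuous_stereo_inv].
pose O : set C := box setT setT `\ 0.
have O1 : O `<=` [set z | stereo_dom 1 (stereo_inv n1 z)] by move=> z _; exact: stereo_inv_dom.
have O2 : O `<=` [set z | stereo_dom (-1) (stereo_inv n1 z)].
  by move=> z [_ /eqP z0]; exact/stereo_inv_north.
have oO : open O.
  by apply: open_punctured; [exact: norm_hausdorff|apply: box_open; exact: openT].
have cO : connected O by apply: punctured_box_connected; (exact: openT) || by [].
have tO : tame (F \o stereo_inv n1) O by apply: tameS (tp 1 n1).
have pO p : stereo_dom 1 p -> stereo_dom (-1) p -> O (stereo 1 p).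
  move=> d1 d2; split => //; apply/eqP; apply/stereo_inv_north.
  by rewrite stereoK.
have -> : [set: S] = stereo_dom 1 `|` stereo_dom (-1).
  by apply/seteqP; split => // p _; exact: stereo_cover.
have o1 : open (stereo_dom (1 : R)) by exact: stereo_dom_open.
have o2 : open (stereo_dom (-1 : R)) by exact: stereo_dom_open.
have [h|h] := branch_agree oO cO tO (branchS O1 (bi _ _ b1)) (branchS O2 (bi _ _ b2)).
  eexists; apply: branch_glue o1 o2 _ b1 b2 _ => [p _|p d1 d2 Fp]; first exact: cF.
  by have := h _ (pO p d1 d2); rewrite /= stereoK//; apply.
eexists; apply: branch_glue o1 o2 _ b1 (branchN b2) _ => [p _|p d1 d2 Fp]; first exact: cF.
by have := h _ (pO p d1 d2); rewrite /= stereoK//; apply.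
Qed.

End lifting.

(** * Counting preimages *)

Section counting.
Context {R : realType}.
Local Notation C := R[i].

Definition counts (T : eqType) (A : set T) (k : nat) : Prop :=
  exists2 l : seq T, uniq l /\ size l = k & forall x, A x <-> x \in l.

Lemma counts_inj (T : eqType) (A : set T) j k : counts A j -> counts A k -> j = k.
Proof.
move=> [l [ul <-] hl] [l' [ul' <-] hl']; apply/perm_size/uniq_perm => // x.
by apply/idP/idP => [/hl/hl'|/hl'/hl].
Qed.

Lemma counts_card (T : choiceType) (A : set T) k : (A #= `I_k)%card -> counts A k.
Proof.
move=> Ak; have fA : finite_set A by apply/finite_setP; exists k.
exists (finmap.enum_fset (fset_set A)); first by split; [exact: finmap.fset_uniq|exact: card_fset_set].
by move=> x; split => [/mem_set|]; rewrite (in_fset_set fA)// => /set_mem.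
Qed.

Lemma eq_counts (T : eqType) (A B : set T) k :
  (forall x, A x <-> B x) -> counts A k -> counts B k.
Proof. by move=> AB [l ul hl]; exists l => // x; rewrite -AB. Qed.

Lemma countsU (T : eqType) (A B : set T) j k : (forall x, A x -> B x -> False) ->
  counts A j -> counts B k -> counts (A `|` B) (j + k).
Proof.
move=> AB [l [ul <-] hl] [l' [ul' <-] hl']; exists (l ++ l'); last first.
  move=> x; rewrite mem_cat; split; first by move=> [/hl ->//|/hl' ->]; rewrite orbT.
  by move=> /orP[/hl|/hl']; [left|right].
split; last by rewrite size_cat.
rewrite cat_uniq ul ul' andbT /=; apply/hasPn => x /hl' Bx; apply/negP => /hl Ax.
exact: (AB x).
Qed.

Lemma counts_bigcup (I T : eqType) (s : seq I) (B : I -> set T) (k : I -> nat) :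
  uniq s -> (forall i, i \in s -> counts (B i) (k i)) ->
  (forall i j x, i \in s -> j \in s -> B i x -> B j x -> i = j) ->
  counts [set x | exists2 i, i \in s & B i x] (sumn [seq k i | i <- s]).
Proof.
elim: s => [_ _ _|i s IH /= /andP[si us] cB dB].
  by exists [::] => // x; split => // -[].
have c1 : counts (B i) (k i) by apply: cB; rewrite mem_head.
have c2 : counts [set x | exists2 j, j \in s & B j x] (sumn [seq k j | j <- s]).
  apply: IH => // [j js|j j' x js js']; first by apply: cB; rewrite inE js orbT.
  by apply: dB; rewrite inE ?js ?js' orbT.
apply: eq_counts (countsU _ c1 c2) => x.
  split=> [[Bx|[j js Bx]]|[j]].
  - by exists i => //; rewrite mem_head.
  - by exists j => //; rewrite inE js orbT.
  - by rewrite inE => /orP[/eqP ->|js] Bx; [left|right; exists j].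
move=> Bx [j js Bx']; move/negP: si; apply.
by rewrite (dB i j x) ?mem_head// inE js orbT.
Qed.

(** The polynomial [X ^ k - c] splits, and it is separable: its derivative [k X ^ (k - 1)] vanishes
    only at 0, which is not a root. *)
Lemma counts_roots (c : C) k : (0 < k)%N -> c != 0 -> counts [set z : C | z ^+ k = c] k.
Proof.
move=> k0 c0; pose p : {poly C} := 'X^k - c%:P.
have sp : size p = k.+1 by rewrite size_XnsubC.
have mp : p \is monic by rewrite monicXnsubC.
have [r pr] := closed_field_poly_normal p.
rewrite (monicP mp) scale1r in pr.
exists r; last first.
  move=> z; rewrite -root_prod_XsubC -pr rootE /p !hornerE subr_eq0.
  by split => /eqP.
split; last by apply: succn_inj; rewrite -(size_prod_XsubC _ id) -pr.
rewrite -separable_prod_XsubC -pr unlock; apply/Pdiv.ClosedField.coprimepP => z.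
rewrite rootE /p !hornerE subr_eq0 => /eqP zk.
rewrite derivB derivC subr0 derivXn hornerMn hornerXn -mulr_natr mulf_neq0//.
  rewrite expf_neq0//; apply: contra_neq c0 => z0.
  by rewrite -zk z0 expr0n eqn0Ngt k0.
by rewrite pnatr_eq0 -lt0n.
Qed.

(** In the charts, this counts the [k]-th roots of a nonzero number. *)
Lemma local_degree_count (X Y : closed_surface R) (f : X -> Y) x k (O : set X) :
  local_degree f x k -> nbhs x O -> exists (U : set X) (V : set Y),
  [/\ nbhs x U, U `<=` O, nbhs (f x) V
    & forall y, V y -> y <> f x -> counts [set u | U u /\ f u = y] k].
Proof.
move=> [k0 [U [phi [V [psi [/chartP[oU [U' [phi' [oU' h1 h2 c1 c1']]]]
  /chartP[oV [V' [psi' [oV' h3 h4 c2 c2']]]] [Ux x0] [Vx y0] e]]]]]] nO.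
have U'0 : U' 0 by rewrite -x0; exact: (h1 _ Ux).1.
have p0 : phi' 0 = x by rewrite -x0; exact: (h1 _ Ux).2.
have nU' : nbhs (0 : C) U' by exact: open_nbhs_nbhs.
have nO' : nbhs (0 : C) (phi' @^-1` O).
  have := c1' 0 U'0; rewrite /continuous_at p0 => c; exact: (c _ nO).
have nUO : nbhs (0 : C) (U' `&` phi' @^-1` O) by exact: filterI.
have /nbhs_ballP[r /= r0 hr] := nUO.
have small (t : C) : 0 < t -> nbhs (0 : C) [set z | `|z| < t].
  move=> t0; have nb : nbhs (0 : C) (ball (0 : C) t) by exact: nbhsx_ballx.
  by apply: filterS nb => z; rewrite -ball_normE /= sub0r normrN.
have hr' z : `|z| < r -> U' z /\ O (phi' z).
  by move=> zr; apply: hr; rewrite -ball_normE /= sub0r normrN.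
(* With radii [r] and [r ^ k], all the [k]-th roots of a point of the target disc lie in the source
   disc. *)
exists [set u | U u /\ `|phi u| < r], [set y | V y /\ `|psi y| < r ^+ k]; split.
- have nU : nbhs x U by exact: open_nbhs_nbhs.
  have := c1 x Ux; rewrite /continuous_at x0 => c.
  exact: (filterI nU (c _ (small r r0))).
- by move=> u [Uu /hr'[_]]; rewrite (h1 u Uu).2.
- have nV : nbhs (f x) V by exact: open_nbhs_nbhs.
  have := c2 (f x) Vx; rewrite /continuous_at y0 => c.
  exact: (filterI nV (c _ (small _ (exprn_gt0 k r0)))).
move=> y [Vy yr] yf.
have psi0 : psi y != 0.
  by apply/eqP => py; apply: yf; rewrite -(h3 y Vy).2 py -y0 (h3 _ Vx).2.
have [l [ul sl] hl] := counts_roots k0 psi0.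
have lr z : z \in l -> `|z| < r.
  move=> /hl /= zk; rewrite -(@ltr_pXn2r _ k)// ?nnegrE ?normr_ge0// ?ltW//.
  by rewrite -normrX zk.
exists [seq phi' z | z <- l].
  split; last by rewrite size_map.
  rewrite map_inj_in_uniq// => z w /lr/hr'[U'z _] /lr/hr'[U'w _] zw.
  by rewrite -(h2 z U'z).2 zw (h2 w U'w).2.
move=> u; split.
  move=> [[Uu ur] fu]; apply/mapP; exists (phi u); last by rewrite (h1 u Uu).2.
  by apply/hl; rewrite /= -(e u Uu).2 fu.
move=> /mapP[z zl ->]; have [U'z _] := hr' z (lr z zl).
have [Uz pz] := h2 z U'z; split; first by split => //; rewrite pz; exact: lr.
have [Vz ez] := e _ Uz.
rewrite -(h3 _ Vz).2 ez pz.
by move/hl : zl => /= ->; rewrite (h3 y Vy).2.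
Qed.

Lemma near_all (T : Type) (I : eqType) (F : set_system T) (FF : Filter F) (s : seq I)
    (P : I -> T -> Prop) :
  (forall i, i \in s -> F (P i)) -> F [set x | forall i, i \in s -> P i x].
Proof.
elim: s => [_|i s IH h]; first by apply: filterS filterT.
have h1 : F (P i) by apply: h; rewrite mem_head.
have h2 : F [set x | forall j, j \in s -> P j x].
  by apply: IH => j js; apply: h; rewrite inE js orbT.
by apply: filterS2 h1 h2 => x Pi Ps j; rewrite inE => /orP[/eqP ->//|/Ps].
Qed.

Lemma disjoint_nbhs (X : topologicalType) (s : seq X) : hausdorff_space X ->
  exists O : X -> set X, (forall p, p \in s -> nbhs p (O p)) /\
    forall p q x, p \in s -> q \in s -> O p x -> O q x -> p = q.
Proof.
rewrite open_hausdorff => hX.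
have /choice[W hW] : forall pq : X * X, exists AB : set X * set X, pq.1 != pq.2 ->
    [/\ nbhs pq.1 AB.1, nbhs pq.2 AB.2 & forall x, AB.1 x -> AB.2 x -> False].
  move=> [p q]; case: (eqVneq p q) => [->|pq]; first by exists (setT, setT); rewrite /= ?eqxx.
  have [[A B] /= [/set_mem Ap /set_mem Bq] [oA oB /eqP AB]] := hX _ _ pq.
  exists (A, B) => _ /=; split; [exact: open_nbhs_nbhs|exact: open_nbhs_nbhs|].
  by move=> x Ax Bx; have : (A `&` B) x by []; rewrite AB.
exists (fun p => [set x | forall q, q \in s -> p != q -> (W (p, q)).1 x /\ (W (q, p)).2 x]).
split => [p ps|p q x ps qs Op Oq].
  apply: near_all => q qs; have [->|pq] := eqVneq p q; first exact: nearW.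
  have [n1 _ _] := hW (p, q) pq.
  have [_ n2 _] := hW (q, p) (introN eqP (fun e => elimN eqP pq (esym e))).
  by apply: filterS2 n1 n2.
apply/eqP; apply: contraT => pq; have [_ _ d] := hW (p, q) pq.
have [A _] := Op q qs pq; have [_ B] := Oq p ps (introN eqP (fun e => elimN eqP pq (esym e))).
by case: (d x A B).
Qed.

(** A continuous map from a compact space to a Hausdorff one is closed: the image of the complement
    of the neighbourhoods is closed and misses [y0]. *)
Lemma near_fiber (X Y : closed_surface R) (f : X -> Y) (y0 : Y) (s : seq X) (U : X -> set X) :
  continuous f -> (forall x, f x = y0 -> x \in s) ->
  (forall p, p \in s -> nbhs p (U p)) ->
  \forall y \near y0, forall x, f x = y -> exists2 p, p \in s & U p x.
Proof.
move=> cf hs nU; pose W := [set x | exists2 p, p \in s & (interior (U p)) x].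
have oW : open W.
  rewrite openE => x [p ps Upx]; rewrite /interior.
  have n1 : nbhs x (interior (U p)) by exact: nbhs_interior.
  by apply: filterS n1 => z ?; exists p.
have cK : closed (f @` (~` W)).
  apply: compact_closed; first exact: surface_hausdorff.
  apply: continuous_compact; first exact: continuous_subspaceT.
  by apply: subclosed_compact (@surface_compact R X) _ => //; exact: open_closedC.
have nK : nbhs y0 (~` (f @` (~` W))).
  apply: open_nbhs_nbhs; split; first exact: closed_openC.
  move=> [x nWx fx]; apply: nWx; exists x; first exact: hs.
  by rewrite /interior; apply: nU; exact: hs.
apply: filterS nK => y ny x fx.
have [p ps Ux] : W x by apply: contrapT => nW; apply: ny; exists x.
by exists p => //; exact: interior_subset Ux.
Qed.

(** When [y0] moves slightly, each point [p] of its fibre breaks into [deg p] distinct points that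
    stay close to [p], and no other preimage appears. *)
Lemma fiber_count (X Y : closed_surface R) (f : X -> Y) (y0 : Y) (s : seq X)
    (deg : X -> nat) (O : X -> set X) :
  continuous f -> uniq s -> (forall x, f x = y0 <-> x \in s) ->
  (forall p, p \in s -> local_degree f p (deg p)) ->
  (forall p, p \in s -> nbhs p (O p)) ->
  exists U : X -> set X, [/\ forall p, p \in s -> U p `<=` O p,
    forall p q x, p \in s -> q \in s -> U p x -> U q x -> p = q
  & \forall y \near y0, y <> y0 ->
      (forall x, f x = y -> exists2 p, p \in s & U p x) /\
      forall p, p \in s -> counts [set u | U p u /\ f u = y] (deg p)].
Proof.
move=> cf us hs hdeg nO.
have [D [nD dD]] := disjoint_nbhs s (@surface_hausdorff R X).
have /choice[UV hUV] : forall p, exists UV : set X * set Y, p \in s ->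
    [/\ nbhs p UV.1, UV.1 `<=` O p `&` D p, nbhs (f p) UV.2
      & forall y, UV.2 y -> y <> f p -> counts [set u | UV.1 u /\ f u = y] (deg p)].
  move=> p; have [ps|ps] := boolP (p \in s); last by exists (setT, setT).
  have [U [V h]] := local_degree_count (hdeg p ps) (filterI (nO p ps) (nD p ps)).
  by exists (U, V).
exists (fun p => (UV p).1); split.
- by move=> p ps x Ux; have [_ h _ _] := hUV p ps; exact: (h x Ux).1.
- move=> p q x ps qs Ux U'x; have [_ h _ _] := hUV p ps; have [_ h' _ _] := hUV q qs.
  by apply: (dD p q x) => //; [exact: (h x Ux).2|exact: (h' x U'x).2].
have n1 : \forall y \near y0, forall x, f x = y -> exists2 p, p \in s & (UV p).1 x.
  apply: near_fiber => // [x|p ps]; first by move/hs.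
  by have [] := hUV p ps.
have n2 : nbhs y0 [set y | forall p, p \in s -> (UV p).2 y].
  apply: near_all => p ps; have [_ _ + _] := hUV p ps.
  by rewrite ((hs p).2 ps).
apply: filterS2 n1 n2 => y h1 h2 yy; split => // p ps.
have [_ _ _ h] := hUV p ps; apply: h; first exact: h2.
by rewrite ((hs p).2 ps).
Qed.

End counting.

(** * The halves of a fibre *)

Section halves.
Context {R : realType}.
Local Notation C := R[i].
Local Notation S := (sphere R).

(** The distance between the centres [c] and [- c] is the sum of the radii. This separates points
    where [G] is close to [w0] from those where it is close to [- w0]. *)
Lemma opposite_discs (c w : C) : `|w - c| < `|c| -> `|w + c| < `|c| -> False.
Proof.
move=> h1 h2; have : `|(w + c) - (w - c)| < `|c| + `|c|.
  by apply: le_lt_trans (ler_normB _ _) _; exact: ltrD.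
have -> : w + c - (w - c) = c + c by ring.
by rewrite -mulr2n -mulr_natr normrM normr_nat mulr_natr mulr2n ltxx.
Qed.

Lemma near_dist (X : topologicalType) (g : X -> C) (x : X) (e : C) :
  0 < e -> continuous_at x g -> \forall u \near x, `|g u - g x| < e.
Proof.
move=> e0 cg; have nb : nbhs (g x) [set v | `|v - g x| < e].
  have nb : nbhs (g x) (ball (g x) e) by exact: nbhsx_ballx.
  by apply: filterS nb => v; rewrite -ball_normE /= distrC.
exact: (cg _ nb).
Qed.

Lemma in_small_disc (c w : C) : `|w - c| < `|c| -> [/\ w != 0, w != - c & w ^+ 2 != c ^+ 2 \/ w = c].
Proof.
move=> h; have w0 : w != 0.
  by apply: contraTneq h => ->; rewrite sub0r normrN ltxx.
have wc : w != - c.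
  apply/eqP => e; apply: (@opposite_discs c w h).
  by rewrite e addNr normr0; apply: le_lt_trans h.
split => //; rewrite eqf_sqr (negbTE wc) orbF.
by have [->|] := eqVneq w c; [right|left].
Qed.

Section fixed_covering.
Variables (f : S -> S) (a b : S) (sz : seq S).
Hypotheses (ba : b <> a) (bf : branched_covering f).
Hypothesis zf : forall p, f p = a \/ f p = b ->
  p \in sz /\ exists2 k, ~~ odd k & local_degree f p k.

Lemma branched_covering_continuous : continuous f.
Proof. by move=> p; have [k] := bf p; exact: local_degree_continuous. Qed.

Lemma covering_square_root : exists (m : S -> C) (n : C -> S) (G : S -> C),
  [/\ continuous n, forall z, n z <> a /\ m (n z) = z,
      forall y, y <> a -> n (m y) = y, m b = 0
    & forall p, f p <> a -> f p <> b ->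
        [/\ m (f p) != 0, G p ^+ 2 = m (f p) & continuous_at p G]].
Proof.
have [m [n [cn nm mn cm mb]]] := sphere_minus_point ba.
(* The value 0 at [a] turns the points over [a] into zeros of [F], so that both even fibres are
   treated alike. *)
pose M (y : S) := if y == a then 0 else m y.
pose F := M \o f.
have M0 y : M y = 0 <-> y = a \/ y = b.
  rewrite /M; have [->|/eqP ya] := eqVneq y a; first by split => //; left.
  split=> [my|[//|->//]]; right.
  by rewrite -(mn y ya) my -mb mn.
have cf := branched_covering_continuous.
have cF p : F p != 0 -> continuous_at p F.
  move=> Fp; have fa : f p <> a by move=> e; move/eqP: Fp; apply; apply/M0; left.
  have cmf : continuous_at p (m \o f).
    exact: (@continuous_comp _ _ _ f m p (cf p) (cm _ fa)).
  have na : \forall q \near p, f q != a.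
    apply: (cf p [set y | y != a]); apply: open_nbhs_nbhs; split; last exact/eqP.
    exact: open_neq sphere_hausdorff.
  by apply: continuous_at_eq cmf; apply: filterS na => q; rewrite /F /M /= => /negbTE ->.
have [G bG] : has_branch F setT.
  apply: (@sphere_has_branch _ F sz) => // p /M0 fp.
  have [psz [k ek dk]] := zf fp; split => //.
  apply: (even_branch_near ek dk); last exact/M0.
  have := near_notin sz p sphere_hausdorff; apply: filterS => q h qp.
  have F0 : F q != 0 by apply/eqP => /M0/zf[qs _]; move: (h qp); rewrite qs.
  by split; [exact: F0|exact: cF].
exists m, n, G; split => // p fa fb.
have FE : F p = m (f p) by rewrite /F /M /=; case: eqP.
have F0 : F p != 0 by apply/eqP => /M0[].
by have [e c] := bG p I F0; split; [rewrite -FE|rewrite -FE|exact: c].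
Qed.

Variables (d : nat) (sb : seq S).
Hypotheses (cd : covering_degree f d) (bs : forall y, branching_point f y -> y \in sb).
Hypothesis ff : forall y, exists s (deg : S -> nat), [/\ uniq s, forall x, f x = y <-> x \in s
  & forall x, x \in s -> local_degree f x (deg x)].

(** The predicate is [G x = w0] for a root [w0] of the coordinate of [y]; both halves have as weight
    the constant number of solutions of [G = w]. *)
Theorem fiber_halves (y : S) (s : seq S) (deg : S -> nat) :
  y <> a -> y <> b -> uniq s -> (forall x, f x = y <-> x \in s) ->
  (forall x, x \in s -> local_degree f x (deg x)) ->
  exists P : pred S, sumn [seq deg x | x <- s & P x] = d./2 /\
                     sumn [seq deg x | x <- s & ~~ P x] = d./2.
Proof.
move=> ya yb us hs hdeg.
have [m [n [G [cn nm mn mb hG]]]] := covering_square_root.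
have cf := branched_covering_continuous.
pose A w := [set p : S | [/\ f p <> a, f p <> b & G p = w]].
have csq : continuous (fun w : C => n (w ^+ 2)).
  move=> w; apply: (@continuous_comp _ _ _ (fun w : C => w ^+ 2) n).
    exact: continuous_exp.
  exact: cn.
have nb z : z != 0 -> n z <> b.
  by move=> z0 e; move/eqP: z0; rewrite -(nm z).2 e mb.
(* For [w] near [w0], the fibre over [n (w ^ 2)] clusters around the points [p] of [t], where [G p]
   is [w0] or [- w0]. By continuity [G = w] holds exactly on the clusters with [G p = w0]. *)
have count w0 t (dg : S -> nat) : w0 != 0 -> uniq t ->
    (forall x, f x = n (w0 ^+ 2) <-> x \in t) ->
    (forall x, x \in t -> local_degree f x (dg x)) ->
    \forall w \near w0, w != w0 -> counts (A w) (sumn [seq dg x | x <- t & G x == w0]).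
  move=> w00 ut ht hdg.
  have w02 : w0 ^+ 2 != 0 by rewrite expf_neq0.
  have hGt p : p \in t -> G p ^+ 2 = w0 ^+ 2 /\ continuous_at p G.
    move=> /ht fp; have [|//|_ e c] := hG p; rewrite ?fp.
    - exact: (nm _).1.
    - exact: nb.
    - by rewrite e fp (nm _).2.
  pose O (p : S) := [set x : S | `|G x - G p| < `|w0|].
  have nO p : p \in t -> nbhs p (O p) by move=> /hGt[_ c]; apply: near_dist c; rewrite normr_gt0.
  have [U [UO dU nU]] := fiber_count cf ut ht hdg nO.
  have n1 : \forall w \near w0, n (w ^+ 2) <> n (w0 ^+ 2) ->
      (forall x, f x = n (w ^+ 2) -> exists2 p, p \in t & U p x) /\
      forall p, p \in t -> counts [set u | U p u /\ f u = n (w ^+ 2)] (dg p).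
    exact: (csq w0 _ nU).
  have n2 : \forall w \near w0, `|w - w0| < `|w0|.
    by apply: (@near_dist C id); [rewrite normr_gt0|exact: cvg_id].
  apply: filterS2 n1 n2 => w h ww /eqP wn; have [w'0 wo [w2|//]] := in_small_disc ww.
  have w20 : w ^+ 2 != 0 by rewrite expf_neq0.
  have yy : n (w ^+ 2) <> n (w0 ^+ 2).
    by move=> e; move/eqP: w2; apply; rewrite -(nm (w ^+ 2)).2 e (nm _).2.
  have [fU cU] := h yy.
  have AE x : A w x <-> exists2 p, p \in [seq x <- t | G x == w0] & U p x /\ f x = n (w ^+ 2).
    split=> [[fa fb Gx]|[p]].
      have [_ e _] := hG x fa fb.
      have fx : f x = n (w ^+ 2) by rewrite -Gx e mn.
      have [p pt Upx] := fU x fx; exists p => //; rewrite mem_filter pt andbT.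
      have /eqP := (hGt p pt).1; rewrite eqf_sqr => /orP[//|/eqP Gp].
      have := UO p pt x Upx; rewrite /O /= Gx Gp opprK => h'.
      by case: (opposite_discs ww h').
    rewrite mem_filter => /andP[/eqP Gp pt] [Upx fx].
    have fa : f x <> a by rewrite fx; exact: (nm _).1.
    have fb : f x <> b by rewrite fx; exact: nb.
    split => //; have [_ + _] := hG x fa fb.
    rewrite fx (nm _).2 => /eqP; rewrite eqf_sqr => /orP[/eqP//|/eqP Gx].
    have := UO p pt x Upx; rewrite /O /= Gx Gp => h'.
    by case: (opposite_discs ww); rewrite -normrN opprD.
  have EA x : (exists2 p, p \in [seq x <- t | G x == w0] & U p x /\ f x = n (w ^+ 2)) <-> A w x.
    exact: iff_sym.
  apply: (eq_counts EA).
  apply: counts_bigcup => [|p|p q x]; first by rewrite filter_uniq.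
    by rewrite mem_filter => /andP[_ pt]; exact: cU.
  rewrite !mem_filter => /andP[_ pt] /andP[_ qt] [Up _] [Uq _].
  exact: dU pt qt Up Uq.
have oS : open ([set: C] `\ 0).
  by apply: open_punctured; [exact: norm_hausdorff|exact: openT].
have cS : connected ([set: C] `\ 0).
  rewrite (_ : [set: C] = box setT setT); last by apply/seteqP.
  by apply: punctured_box_connected; (exact: openT) || by [].
(* The set of all counts of [A w] is a total function of [w], so constancy can be stated before
   [A w] is known to be finite. *)
have single w k : counts (A w) k -> [set j | counts (A w) j] = [set k].
  by move=> ck; apply/seteqP; split => j /= cj; [exact: counts_inj cj ck|rewrite cj].
have [c hc] : exists c, forall w0, ([set: C] `\ 0) w0 ->
    \forall w \near w0, w != w0 -> [set j | counts (A w) j] = c.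
  apply: eventually_constant => // w0 [_ /eqP w00].
  have [t [dg [ut ht hdg]]] := ff (n (w0 ^+ 2)).
  exists [set sumn [seq dg x | x <- t & G x == w0]].
  by apply: filterS (count w0 t dg w00 ut ht hdg) => w h /h/single.
(* At [w0] itself points may be multiple. Comparing with a nearby [w] identifies the weighted count
   at [w0] with the constant. *)
have value w0 t (dg : S -> nat) : w0 != 0 -> uniq t ->
    (forall x, f x = n (w0 ^+ 2) <-> x \in t) ->
    (forall x, x \in t -> local_degree f x (dg x)) ->
    c = [set sumn [seq dg x | x <- t & G x == w0]].
  move=> w00 ut ht hdg; have w0S : ([set: C] `\ 0) w0 by split => //; exact/eqP.
  have [w ww [h1 h2]] := punctured_nbhs (filterI (hc w0 w0S) (count w0 t dg w00 ut ht hdg)).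
  by rewrite -(h1 ww); apply: single; exact: h2.
have [k ck] : exists k, c = [set k].
  have [t [dg [ut ht hdg]]] := ff (n (1 ^+ 2)).
  by eexists; apply: (value 1 t dg) => //; exact: oner_neq0.
(* For a suitable [w] near 1, [n (w ^ 2)] is not a branching point. Its fibre has [d] points and is
   the disjoint union of [A w] and [A (- w)], of [k] points each. *)
have kd : (k + k)%N = d.
  have v1 : ([set: C] `\ 0) 1 by split => //; apply/eqP; exact: oner_neq0.
  have v2 : ([set: C] `\ 0) (-1) by split => //; apply/eqP; rewrite oppr_eq0 oner_neq0.
  have n1 := hc 1 v1.
  have n2 : \forall w \near (1 : C), - w != -1 -> [set j | counts (A (- w)) j] = c.
    have cN : continuous_at (1 : C) (fun w : C => - w) by exact: (continuousN cvg_id).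
    exact: (cN _ (hc (-1) v2)).
  have n3 : \forall w \near (1 : C), n (w ^+ 2) != n (1 ^+ 2) -> n (w ^+ 2) \notin sb.
    exact: (csq 1 _ (near_notin sb (n (1 ^+ 2)) sphere_hausdorff)).
  (* This keeps [w] away from 0 and -1, so that [w ^ 2] differs from 1 and [n3] applies. *)
  have n4 : \forall w \near (1 : C), `|w - 1| < `|1 : C|.
    by apply: (@near_dist C id); [rewrite normr1|exact: cvg_id].
  have [w w1 [[h1 h2] [h3 h4]]] := punctured_nbhs (filterI (filterI n1 n2) (filterI n3 n4)).
  have [w0 _ [w2|w1']] := in_small_disc h4; last by rewrite w1' eqxx in w1.
  have k1 : counts (A w) k.
    have : [set j | counts (A w) j] k by rewrite (h1 w1) ck.
    by [].
  have k2 : counts (A (- w)) k.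
    have : [set j | counts (A (- w)) j] k by rewrite h2 ?ck// (inj_eq oppr_inj).
    by [].
  have ny : n (w ^+ 2) != n (1 ^+ 2).
    by apply: contra_neq w2 => e; rewrite -(nm (w ^+ 2)).2 e (nm _).2.
  have w20 : w ^+ 2 != 0 by rewrite expf_neq0.
  have cw : counts (f @^-1` [set n (w ^+ 2)]) d.
    apply: counts_card; apply: cd => /bs; apply/negP; exact: h3.
  apply: (counts_inj _ cw).
  apply: eq_counts (countsU _ k1 k2) => [x|x [_ _ e] [_ _]]; last first.
    by move=> /eqP; rewrite e -addr_eq0 -mulr2n -mulr_natr mulf_eq0 (negbTE w0) pnatr_eq0.
  split=> [[[fa fb e]|[fa fb e]]|fx].
  - by have [_ e' _] := hG x fa fb; rewrite /= -e e' mn.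
  - by have [_ e' _] := hG x fa fb; rewrite /= -(sqrrN w) -e e' mn.
  have fa : f x <> a by rewrite fx; exact: (nm _).1.
  have fb : f x <> b by rewrite fx; exact: nb.
  have [_ + _] := hG x fa fb; rewrite fx (nm _).2 => /eqP.
  by rewrite eqf_sqr => /orP[/eqP e|/eqP e]; [left|right].
have my0 : m y != 0 by apply/eqP => e; apply: yb; rewrite -(mn y ya) e -mb mn.
pose w0 := sqrtC (m y).
have w00 : w0 != 0 by rewrite sqrtC_eq0.
have ny : n (w0 ^+ 2) = y by rewrite sqrtCK mn.
have hd2 : d./2 = k by rewrite -kd addnn doubleK.
have ksum t : c = [set t] -> t = d./2.
  by rewrite ck hd2 => e; have : [set k] t by rewrite e.
exists (fun x => G x == w0); split; apply: ksum.
  by apply: value => // x; rewrite ny.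
(* On the fibre [G] is [w0] or [- w0], so the second half is the first one for the other root. *)
have -> : [seq x <- s | ~~ (G x == w0)] = [seq x <- s | G x == - w0].
  apply: eq_in_filter => x /hs fx.
  have [_ e _] : [/\ m (f x) != 0, G x ^+ 2 = m (f x) & continuous_at x G].
    by apply: hG; rewrite fx.
  have : G x ^+ 2 == w0 ^+ 2 by rewrite e fx sqrtCK.
  rewrite eqf_sqr; have [->|//] := eqVneq (G x) w0 => _.
  by rewrite -addr_eq0 -mulr2n -mulr_natr mulf_eq0 (negbTE w00) pnatr_eq0.
by apply: value => //; [rewrite oppr_eq0|move=> x; rewrite sqrrN ny].
Qed.

End fixed_covering.

End halves.

(* The partitions are indexed from 0: the first two are those with (i < 2)%N. *)
Theorem theorem1p5 (R : realType) (n d : nat)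
    (D : branch_datum (sphere R) (sphere R) n d) :
  (2 <= n)%N ->
  ~~ odd d ->
  (forall i : 'I_n, (i < 2)%N -> all (fun k : nat => ~~ odd k) (D i)) ->
  realizable D ->
  forall i : 'I_n, (2 <= i)%N -> refines_halves d (D i).
Proof.
move=> n2 _ evD [f [x [bf cd injx brx loc]]] i i2.
pose j0 : 'I_n := Ordinal (ltnW n2); pose j1 : 'I_n := Ordinal n2.
have xne (j : 'I_n) k : j != k -> x j <> x k by move=> jk /injx e; rewrite e eqxx in jk.
have locE j : exists s (deg : sphere R -> nat), [/\ uniq s, forall p, f p = x j <-> p \in s,
    forall p, p \in s -> local_degree f p (deg p)
  & perm_eq [seq deg p | p <- s] (D j)].
  have [s [deg [us fs hd pD]]] := loc j; exists s, deg; split => // p.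
  by rewrite (_ : (f p = x j) = (f @^-1` [set x j]) p)// fs.
have [s0 [deg0 [_ h0 hd0 p0]]] := locE j0; have [s1 [deg1 [_ h1 hd1 p1]]] := locE j1.
have zf p : f p = x j0 \/ f p = x j1 ->
    p \in s0 ++ s1 /\ exists2 k, ~~ odd k & local_degree f p k.
  rewrite mem_cat => -[/h0 ps|/h1 ps]; rewrite ps ?orbT; split => //.
    exists (deg0 p); last exact: hd0.
    by apply: (allP (evD j0 isT)); rewrite -(perm_mem p0) map_f.
  exists (deg1 p); last exact: hd1.
  by apply: (allP (evD j1 isT)); rewrite -(perm_mem p1) map_f.
have bs y : branching_point f y -> y \in [seq x j | j <- enum 'I_n].
  by move=> /brx[j <-]; rewrite map_f// mem_enum.
(* Every fibre is finite: over a branching point it is one of the prescribed fibres, elsewhere it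
   has [d] points. *)
have ff y : exists s (deg : sphere R -> nat), [/\ uniq s, forall p, f p = y <-> p \in s
    & forall p, p \in s -> local_degree f p (deg p)].
  case: (pselect (branching_point f y)) => [/brx[j <-]|nbr].
    by have [s [deg [? ? ? _]]] := locE j; exists s, deg.
  have [s [us _] hs] := counts_card (cd y nbr).
  by have [deg hdeg] := choice bf; exists s, deg; split.
have [s [deg [us hs hdeg pD]]] := locE i.
have ij (j : 'I_n) : (j < 2)%N -> i != j.
  by move=> j2; apply: contraTneq i2 => ->; rewrite -ltnNge.
have [P [e1 e2]] := fiber_halves (xne j1 j0 isT) bf zf cd bs ff
  (xne i j0 (ij j0 isT)) (xne i j1 (ij j1 isT)) us hs hdeg.
have pos (Q : pred (sphere R)) : all (fun k => 0 < k)%N [seq deg p | p <- s & Q p].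
  apply/allP => k /mapP[p]; rewrite mem_filter => /andP[_ ps] ->.
  by have [] := hdeg p ps.
exists [seq deg p | p <- s & P p], [seq deg p | p <- s & ~~ P p]; split => //.
rewrite -map_cat; apply: (perm_trans _ (perm_map deg _)); first by rewrite perm_sym; exact: pD.
by rewrite perm_sym; apply/permPl/perm_filterC.
Qed.
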